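(* Let $2<\alpha<Q$. Then for every $\phi\in C_0^\infty(\mathbb{R}^n\setminus\{0\})$, $$\int_{\mathbb{R}^n}\rho^{\alpha}\frac{|\Delta_\gamma\phi|^2}{|\nabla_\gamma\rho|^2}\,dz\ \ge\ \frac{(Q-\alpha)^2}{4}\int_{\mathbb{R}^n}\rho^{\alpha}\frac{|\nabla_\gamma\phi|^2}{\rho^2}\,dz .$$ Moreover the constant $\big(\frac{Q-\alpha}{2}\big)^2$ is sharp, i.e. it equals the infimum of the ratio of the left-hand integral to $\int_{\mathbb{R}^n}\rho^{\alpha-2}|\nabla_\gamma\phi|^2\,dz$ over all nonzero admissible $\phi$.
   Context: Points of $\mathbb{R}^n$ are written $z=(x,y)$ with $x\in\mathbb{R}^m$, $y\in\mathbb{R}^k$, $m,k\ge1$, $n=m+k$, and $\gamma>0$. The Baouendi–Grushin gradient is $\nabla_\gamma=(\partial_{x_1},\dots,\partial_{x_m},|x|^\gamma\partial_{y_1},\dots,|x|^\gamma\partial_{y_k})$, and the Baouendi–Grushin operator is $\Delta_\gamma=\nabla_\gamma\cdot\nabla_\gamma=\Delta_x+|x|^{2\gamma}\Delta_y$. The homogeneous dimension is $Q=m+(1+\gamma)k$. The gauge is $\rho(z)=\big(|x|^{2(1+\gamma)}+(1+\gamma)^2|y|^2\big)^{\frac{1}{2(1+\gamma)}}$; one has $|\nabla_\gamma\rho|=|x|^\gamma/\rho^\gamma$. The integral on the left-hand side is allowed to be $+\infty$. *)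

(* Defs.v *)
From HB Require Import structures.
From mathcomp Require Import all_boot all_order all_algebra.
From mathcomp Require Import all_classical all_reals all_analysis.
Set Implicit Arguments. Unset Strict Implicit. Unset Printing Implicit Defensive.
Import Order.TTheory GRing.Theory Num.Theory.
Import numFieldNormedType.Exports.
Local Open Scope classical_set_scope.
Local Open Scope ring_scope.

Section Grushin.
Variable R : realType.

(* Iterated Lebesgue integral over R^n of a function with values in \bar R.
   For nonnegative measurable integrands this equals the integral w.r.t.
   n-dimensional Lebesgue measure (Tonelli). *)
Fixpoint iint (n : nat) : ('rV[R]_n -> \bar R) -> \bar R :=
  match n with
  | 0 => fun f => f 0
  | n'.+1 => fun f =>
      (\int[@lebesgue_measure R]_(t in setT)
         iint (fun v : 'rV[R]_n' => f (row_mx (\row_(_ < 1) t) v)))%E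
  end.

Definition pd (n : nat) (i : 'I_n) (f : 'rV[R]_n -> R) : 'rV[R]_n -> R :=
  fun z => 'D_(delta_mx 0 i) f z.

Definition smooth (n : nat) (f : 'rV[R]_n -> R) : Prop :=
  forall s : seq 'I_n, forall z, differentiable (foldr (@pd n) f s) z.

Definition admissible (n : nat) (f : 'rV[R]_n -> R) : Prop :=
  smooth f /\
  exists K : set 'rV[R]_n, compact K /\ ~ K 0 /\ (forall z, ~ K z -> f z = 0).

Definition enorm (p : nat) (v : 'rV[R]_p) : R := Num.sqrt (\sum_(i < p) v 0 i ^+ 2).

Variables (m k : nat) (gamma : R).

Definition xpart (z : 'rV[R]_(m + k)) : 'rV[R]_m := lsubmx z.
Definition ypart (z : 'rV[R]_(m + k)) : 'rV[R]_k := rsubmx z.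

Definition px (i : 'I_m) (f : 'rV[R]_(m + k) -> R) := pd (lshift k i) f.
Definition py (j : 'I_k) (f : 'rV[R]_(m + k) -> R) := pd (rshift m j) f.

Definition xw (z : 'rV[R]_(m + k)) : R := enorm (xpart z) `^ gamma.

Definition grad_gamma_sq (f : 'rV[R]_(m + k) -> R) (z : 'rV[R]_(m + k)) : R :=
  \sum_(i < m) (px i f z) ^+ 2 + \sum_(j < k) (xw z * py j f z) ^+ 2.

Definition grushin (f : 'rV[R]_(m + k) -> R) (z : 'rV[R]_(m + k)) : R :=
  \sum_(i < m) px i (px i f) z + (xw z) ^+ 2 * \sum_(j < k) py j (py j f) z.

Definition Qdim : R := m%:R + (1 + gamma) * k%:R.

Definition rho (z : 'rV[R]_(m + k)) : R :=
  (enorm (xpart z) `^ (2 * (1 + gamma)) + (1 + gamma) ^+ 2 * enorm (ypart z) ^+ 2)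
    `^ (1 / (2 * (1 + gamma))).

(* left-hand side: int rho^alpha |Delta_gamma f|^2 / |nabla_gamma rho|^2 dz
   (the denominator vanishes only on the null set {x = 0}) *)
Definition lhs_int (alpha : R) (f : 'rV[R]_(m + k) -> R) : \bar R :=
  iint (fun z => (rho z `^ alpha * (grushin f z) ^+ 2 / grad_gamma_sq rho z)%:E).

Definition rhs_int (alpha : R) (f : 'rV[R]_(m + k) -> R) : \bar R :=
  iint (fun z => (rho z `^ alpha * grad_gamma_sq f z / rho z ^+ 2)%:E).

Definition den_int (alpha : R) (f : 'rV[R]_(m + k) -> R) : \bar R :=
  iint (fun z => (rho z `^ (alpha - 2) * grad_gamma_sq f z)%:E).

End Grushin.

(* Main.v *)
Require Import Defs.
From HB Require Import structures.
From mathcomp Require Import all_boot all_order all_algebra.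
From mathcomp Require Import all_classical all_reals all_analysis.
From mathcomp Require Import ring lra.

(** Write [rho = gauge ^ (1 / (2 g))] with [g = 1 + gamma] and
    [gauge = |x|^(2 g) + g^2 |y|^2], put [b = alpha - 2],
    [w = |x|^(2 gamma) * gauge^(b / (2 g) - 1)], and let [E phi] be the
    derivative of [phi] along the dilation field [x . d_x + g y . d_y].
    Integrating [Delta_gamma phi * phi] by parts against [rho^b] gives an
    identity between [Delta_gamma phi], [|nabla_gamma phi|^2] and [w phi E phi],
    and integrating the divergence of a multiple of the dilation field gives
    one between [w phi E phi] and [w phi^2].  Modulo these two null integrands
    the difference of the two sides of the inequality is a square in
    [Delta_gamma phi] plus a nonnegative multiple of [rho^b] times a sum of
    squares of first order quantities.

    For the sharpness, insert [phi = gauge^(- s) psi (d * ln gauge)] with [psi] a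
    bump function.  Functionals of profiles in [ln gauge] annihilate derivatives,
    so they are multiples of the Lebesgue integral of the profile; the excess of
    the quotient over the constant is therefore of order [d^2].  Since [gauge] is
    not smooth on [x = 0], [|x|^(2 g)] is first multiplied by
    [exp (- e / |x|^2)], and [e] tends to 0 for fixed [d]: the weight
    [|x|^(- 2 gamma)] of the left-hand side is compensated because the
    regularized Laplacian carries a factor [|x|^(2 gamma)] uniformly in [e]. *)

Set Implicit Arguments.
Unset Strict Implicit.
Unset Printing Implicit Defensive.
Import Order.TTheory GRing.Theory Num.Theory.
Import numFieldNormedType.Exports.
Local Open Scope classical_set_scope.
Local Open Scope ring_scope.

(** The integrals are iterated and the left integrand is singular on x = 0, so measurability of its
    partial integrals is not at hand. Identities are therefore proved for continuous functions
    supported in a box, by induction on the dimension, and for a general [phi] the left-hand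
    integral is only bounded below by such a function off a coordinate hyperplane. Every constant
    comes from the virtual extremal rho^(- a / 2) with a = Q + alpha - 4. Off x = 0 it satisfies
    Delta_gamma f = - (a (Q - alpha) / 4) |nabla_gamma rho|^2 rho^(- 2) f, and both squares of the
    inequality vanish on it. Its integrals diverge logarithmically, hence the cutoff spread over a
    range of ln gauge of order 1 / d. Polar coordinates adapted to the gauge would evaluate the
    integrals that remain; the divergence identity of the dilation field, with a weight of
    homogeneity - Q, replaces them. *)

(* Typeclass search does not see through the nested filter of a matrix type. *)
#[global] Instance rV_filter (R : realType) n (v : 'rV[R]_n) : Filter (nbhs v).
Proof. exact: nbhs_filter. Qed.

(** * Iterated integrals of continuous functions supported in a box *)

Section compactly_supported_integrals.
Variable R : realType.
Notation leb := (@lebesgue_measure R).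

Definition vcons n (t : R) (v : 'rV[R]_n) : 'rV[R]_n.+1 :=
  row_mx (\row_(_ < 1) t) v.

Lemma vcons0 n t (v : 'rV[R]_n) : vcons t v 0 0 = t.
Proof.
transitivity (row_mx (\row_(_ < 1) t) v 0 (lshift n 0)).
  by congr (fun_of_matrix _ _ _); exact: val_inj.
by rewrite row_mxEl mxE.
Qed.

Lemma vconsS n t (v : 'rV[R]_n) i : vcons t v 0 (lift ord0 i) = v 0 i.
Proof.
transitivity (row_mx (\row_(_ < 1) t) v 0 (rshift 1 i)).
  by congr (fun_of_matrix _ _ _); exact: val_inj.
by rewrite row_mxEr.
Qed.

Lemma vcons_eta n (z : 'rV[R]_n.+1) :
  z = vcons (z 0 0) (\row_i z 0 (lift ord0 i)).
Proof.
apply/rowP => j; case: (unliftP ord0 j) => [i ->|->].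
  by rewrite vconsS mxE.
by rewrite vcons0.
Qed.

Lemma rV_cvgP (T : Type) (F : set_system T) {FF : Filter F} n
    (f : T -> 'rV[R]_n) (l : 'rV[R]_n) :
  (forall i, (fun x => f x 0 i) @ F --> l 0 i) -> f @ F --> l.
Proof.
move=> fl; apply/cvg_ballP => e e0.
have : \forall x \near F, forall i, ball (l 0 i) e (f x 0 i).
  apply: filter_forall => i.
  have /cvg_ballP := fl i; exact.
apply: filterS => x H; split => // i j; rewrite (ord1 i); exact: H.
Qed.

Lemma cvg_vcons (T : Type) (F : set_system T) {FF : Filter F} n
    (f : T -> R) (g : T -> 'rV[R]_n) (a : R) (b : 'rV[R]_n) :
  f @ F --> a -> g @ F --> b ->
  (fun x => vcons (f x) (g x)) @ F --> vcons a b.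
Proof.
move=> fa gb; apply: rV_cvgP => j; case: (unliftP ord0 j) => [i ->|->].
  rewrite (_ : (fun x => _) = (fun x => g x 0 i)); last first.
    by apply/funext => x; rewrite vconsS.
  rewrite vconsS; apply: (@cvg_comp _ _ _ g (fun v : 'rV[R]_n => v 0 i) _ _ _ gb).
  exact: coord_continuous.
rewrite (_ : (fun x => _) = f); first by rewrite vcons0.
by apply/funext => x; rewrite vcons0.
Qed.

Definition box n (M : R) : set 'rV[R]_n := [set z | forall i, `|z 0 i| <= M].

Lemma box_compact n M : compact (@box n M).
Proof.
rewrite (_ : box M = [set v : 'rV[R]_n | forall i, `[- M, M]%classic (v ord0 i)]).
  apply: (@rV_compact _ _ (fun=> `[- M, M]%classic)) => i; exact: segment_compact.
apply/seteqP; split => z /= H i; have := H i; by rewrite /= in_itv/= ler_norml.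
Qed.

Definition CC n (M : R) (f : 'rV[R]_n -> R) :=
  continuous f /\ forall z, ~ box M z -> f z = 0.

Fixpoint ri n : ('rV[R]_n -> R) -> R :=
  match n with
  | 0 => fun f => f 0
  | n'.+1 => fun f => \int[leb]_t ri (fun v : 'rV[R]_n' => f (vcons t v))
  end.

Lemma box_vcons n M t (v : 'rV[R]_n) :
  box M (vcons t v) <-> `|t| <= M /\ box M v.
Proof.
split=> [H|[tM vM] j].
  split; first by have := H 0; rewrite vcons0.
  by move=> i; have := H (lift ord0 i); rewrite vconsS.
by case: (unliftP ord0 j) => [i ->|->]; rewrite ?vconsS ?vcons0.
Qed.

Lemma CC_slice n M (f : 'rV[R]_n.+1 -> R) t :
  CC M f -> CC M (fun v => f (vcons t v)).
Proof.
move=> [cf sf]; split.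
  move=> v; apply: (@cvg_comp _ _ _ (fun v => vcons t v) f _ (nbhs (vcons t v))).
    by apply: cvg_vcons; [exact: cvg_cst|exact: cvg_id].
  exact: cf.
by move=> v vM; apply: sf => /box_vcons[].
Qed.

Lemma CCD n M (f g : 'rV[R]_n -> R) :
  CC M f -> CC M g -> CC M (fun z => f z + g z).
Proof.
move=> [cf sf] [cg sg]; split.
  by move=> z; apply: cvgD; [exact: cf|exact: cg].
by move=> z zM; rewrite sf// sg// addr0.
Qed.

Lemma CCZ n M (f : 'rV[R]_n -> R) (c : R) : CC M f -> CC M (fun z => c * f z).
Proof.
move=> [cf sf]; split.
  by move=> z; apply: cvgM; [exact: cvg_cst|exact: cf].
by move=> z zM; rewrite sf// mulr0.
Qed.

Lemma CC0 n M : CC M (fun _ : 'rV[R]_n => 0 : R).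
Proof. by split=> // z; exact: cvg_cst. Qed.

Lemma CC_le n M M' (f : 'rV[R]_n -> R) : M <= M' -> CC M f -> CC M' f.
Proof.
move=> MM' [cf sf]; split=> // z zM'; apply: sf => zM; apply: zM' => i.
exact: le_trans (zM i) MM'.
Qed.

(** Tube lemma: by compactness of [K], joint continuity at the points of the slice over [t0] already
    gives uniformity. *)
Lemma near_unif (T : topologicalType) n (f : T -> 'rV[R]_n -> R) (t0 : T)
    (K : set 'rV[R]_n) (e : R) : compact K -> 0 < e ->
  (forall z, K z -> {for (t0, z), continuous (fun p : T * 'rV[R]_n => f p.1 p.2)}) ->
  \forall t \near t0, forall z, K z -> `|f t z - f t0 z| < e.
Proof.
move=> cK e0 cf.
have := (compact_near_coveringP K).1 cK T (nbhs t0)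
  (fun t z => `|f t z - f t0 z| < e) _.
move=> /(_ _) H; suff : \forall t \near t0, K `<=` (fun z => `|f t z - f t0 z| < e).
  by apply: filterS => t Ht z Kz; exact: Ht.
apply: H => z Kz.
have e2 : 0 < e / 2 by rewrite divr_gt0.
have /cvgrPdist_lt /(_ _ e2) H1 := cf z Kz.
have [[A B] /= [At Bz] AB] : \forall p \near (t0, z), `|f t0 z - f p.1 p.2| < e / 2 by exact: H1.
exists (B, A) => //= -[z' t] /= [Bz' At'].
have h1 := AB (t, z') (conj At' Bz').
have h2 := AB (t0, z') (conj (nbhs_singleton At) Bz').
rewrite /= in h1 h2.
rewrite (_ : f t z' - f t0 z' = (f t0 z - f t0 z') - (f t0 z - f t z')); last by ring.
by apply: le_lt_trans (ler_normB _ _) _; rewrite (splitr e) ltrD.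
Qed.

Definition CCfun1 (M : R) (F : R -> R) := continuous F /\ forall t, M < `|t| -> F t = 0.

Lemma CC1_itv M F : CCfun1 M F -> (EFin \o F) = (EFin \o F) \_ `[- M, M]%classic.
Proof.
move=> [_ sF]; apply/funext => t; rewrite /patch; case: ifPn => //.
rewrite notin_setE /= in_itv /= -ler_norml => /negP; rewrite -ltNge => /sF.
by move=> ->.
Qed.

Lemma CC1_integrable M F : CCfun1 M F -> leb.-integrable setT (EFin \o F).
Proof.
move=> cF; rewrite (CC1_itv cF); have mI : measurable (`[- M, M]%classic : set R) by exact: measurable_itv.
apply: (integrable_mkcond (mu := leb) (EFin \o F) mI).1.
apply: continuous_compact_integrable; first exact: segment_compact.
by apply: continuous_subspaceT => x; exact: cF.1.
Qed.

Lemma CC1_bound M F c : 0 <= M -> CCfun1 M F -> (forall t, `|F t| <= c) ->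
  `|\int[leb]_t F t| <= c * (2 * M).
Proof.
move=> M0 cF Fc; apply: le_trans (le_normr_Rintegral _ _) _ => //.
  exact: CC1_integrable cF.
have -> : \int[leb]_t `|F t| = \int[leb]_(t in `[- M, M]%classic) `|F t|.
  rewrite [RHS]Rintegral_mkcond; apply: eq_Rintegral => t _.
  rewrite /patch; case: ifPn => //.
  rewrite notin_setE /= in_itv /= -ler_norml => /negP; rewrite -ltNge => /cF.2 ->.
  by rewrite normr0.
have mI : measurable `[- M, M]%classic by exact: measurable_itv.
have -> : c * (2 * M) = \int[leb]_(t in `[- M, M]%classic) c.
  rewrite Rintegral_cst//= lebesgue_measure_itv /= lte_fin.
  case: ifPn => [_|]; first by rewrite /=; congr (_ * _); ring.
  rewrite -leNgt => h /=; rewrite (_ : M = 0) ?mulr0//; lra.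
apply: le_Rintegral => //.
  apply: continuous_compact_integrable; first exact: segment_compact.
  apply: continuous_subspaceT => x; apply: cvg_norm; exact: cF.1.
apply: continuous_compact_integrable; first exact: segment_compact.
apply: continuous_subspaceT => x; exact: cvg_cst.
Qed.

(** These facts are proved by one induction: in dimension n + 1 the outer integral needs a
    continuous slice integral, whose continuity rests on linearity and on the bound in dimension
    n. *)
Definition ri_props n :=
  [/\ forall M (f g : 'rV[R]_n -> R), CC M f -> CC M g ->
        ri (fun z => f z + g z) = ri f + ri g,
      forall M (f : 'rV[R]_n -> R) c, CC M f -> ri (fun z => c * f z) = c * ri f,
      forall M (f : 'rV[R]_n -> R) c, 0 <= M -> CC M f ->
        (forall z, `|f z| <= c) -> `|ri f| <= c * (2 * M) ^+ n &
      forall M (f : 'rV[R]_n -> R), CC M f -> iint (fun z => (f z)%:E) = (ri f)%:E].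

Lemma ri_param_cvg_of n (T : topologicalType) (t0 : T) M (f : T -> 'rV[R]_n -> R) :
  ri_props n ->
  (\forall t \near t0, CC M (f t)) ->
  (forall z, {for (t0, z), continuous (fun p : T * 'rV[R]_n => f p.1 p.2)}) ->
  ri (f t) @[t --> t0] --> ri (f t0).
Proof.
move=> [HD HZ HB _] cf jf; pose M' := Num.max M 0.
have M'0 : 0 <= M' by rewrite le_max lexx orbT.
have {}cf : \forall t \near t0, CC M' (f t).
  by apply: filterS cf => t; apply: CC_le; rewrite le_max lexx.
have cf0 := nbhs_singleton cf.
apply/cvgrPdist_lt => e e0.
pose d := e / ((2 * M') ^+ n + 1).
have K0 : 0 < (2 * M') ^+ n + 1 by rewrite ltr_wpDl// exprn_ge0// mulr_ge0.
have d0 : 0 < d by rewrite divr_gt0.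
have := near_unif (@box_compact n M') d0 (fun z _ => jf z).
apply: filterS2 cf => t cft Ht.
have -> : ri (f t0) - ri (f t) = ri (fun z => f t0 z + (-1) * f t z).
  rewrite (HD M')//; last exact: CCZ.
  by rewrite (HZ M')// mulN1r.
apply: (@le_lt_trans _ _ (d * (2 * M') ^+ n)).
  apply: (HB M') => //; first by apply: CCD => //; exact: CCZ.
  move=> z; have [zM|zM] := pselect (box M' z).
    by rewrite mulN1r distrC ltW// Ht.
  by rewrite cft.2// cf0.2// mulr0 addr0 normr0 ltW.
by rewrite /d mulrAC ltr_pdivrMr// ltr_pM2l// ltrDl.
Qed.

Lemma slice_CC1_of n M (f : 'rV[R]_n.+1 -> R) : ri_props n -> CC M f ->
  CCfun1 M (fun t => ri (fun v : 'rV[R]_n => f (vcons t v))).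
Proof.
move=> Hn cf; split.
  move=> t0; apply: (@ri_param_cvg_of _ _ _ M (fun t v => f (vcons t v))) => //.
    by apply: (@filterS _ (nbhs t0) _ setT) filterT => t _; exact: CC_slice.
  move=> z; apply: (@cvg_comp _ _ _ (fun p : R * 'rV[R]_n => vcons p.1 p.2) f
      _ (nbhs (vcons t0 z))).
    by apply: (@cvg_vcons _ _ _ _ fst snd); [exact: cvg_fst|exact: cvg_snd].
  exact: cf.1.
(* The zero function is written as a multiple of zero, so that homogeneity gives a zero integral. *)
move=> t Mt; have -> : (fun v => f (vcons t v)) = fun v : 'rV[R]_n => 0 * 0.
  apply/funext => v; rewrite mul0r cf.2// => /box_vcons[]; by rewrite leNgt Mt.
by case: Hn => _ HZ _ _; rewrite (HZ M (fun=> 0))// ?mul0r//; exact: CC0.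
Qed.

Lemma ri_propsP n : ri_props n.
Proof.
elim: n => [|n IH].
  split => //=.
  by move=> M f c M0 cf fc; rewrite expr0 mulr1.
have [HD HZ HB HE] := IH.
have I M (f : 'rV[R]_n.+1 -> R) : CC M f ->
    leb.-integrable setT (fun t => (ri (fun v : 'rV[R]_n => f (vcons t v)))%:E).
  by move=> cf; exact: (CC1_integrable (slice_CC1_of IH cf)).
split.
- move=> M f g cf cg /=; rewrite -RintegralD//; [|exact: I cf|exact: I cg].
  apply: eq_Rintegral => t _; apply: (HD M); exact: CC_slice.
- move=> M f c cf /=; rewrite -RintegralZl//; last exact: I cf.
  apply: eq_Rintegral => t _; apply: (HZ M); exact: CC_slice.
- move=> M f c M0 cf fc /=; rewrite exprSr mulrA.
  apply: CC1_bound => //; first exact: slice_CC1_of.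
  by move=> t; apply: HB => //; exact: CC_slice.
- move=> M f cf /=.
  rewrite (_ : (fun t => iint _) =
      (fun t => (ri (fun v : 'rV[R]_n => f (vcons t v)))%:E)); last first.
    by apply/funext => t; apply: (HE M); exact: CC_slice.
  by rewrite /Rintegral fineK//; apply: integrable_fin_num => //; exact: I cf.
Qed.

Lemma riD n M (f g : 'rV[R]_n -> R) : CC M f -> CC M g ->
  ri (fun z => f z + g z) = ri f + ri g.
Proof. by case: (ri_propsP n) => H _ _ _; exact: H. Qed.

Lemma riZ n M (f : 'rV[R]_n -> R) c : CC M f -> ri (fun z => c * f z) = c * ri f.
Proof. by case: (ri_propsP n) => _ H _ _; exact: H. Qed.

Lemma iint_ri n M (f : 'rV[R]_n -> R) : CC M f ->
  iint (fun z => (f z)%:E) = (ri f)%:E.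
Proof. by case: (ri_propsP n) => _ _ _ H; exact: H. Qed.

Lemma ri0 n : ri (fun _ : 'rV[R]_n => 0) = 0.
Proof.
transitivity (ri (fun _ : 'rV[R]_n => 0 * 0)).
  by congr ri; apply/funext => z; rewrite mul0r.
by rewrite (riZ 0 (@CC0 n 0)) mul0r.
Qed.

Lemma ri_param_cvg n (T : topologicalType) (t0 : T) M (f : T -> 'rV[R]_n -> R) :
  (\forall t \near t0, CC M (f t)) ->
  (forall z, {for (t0, z), continuous (fun p : T * 'rV[R]_n => f p.1 p.2)}) ->
  ri (f t) @[t --> t0] --> ri (f t0).
Proof. exact/ri_param_cvg_of/ri_propsP. Qed.

Lemma slice_CC1 n M (f : 'rV[R]_n.+1 -> R) : CC M f ->
  CCfun1 M (fun t => ri (fun v : 'rV[R]_n => f (vcons t v))).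
Proof. exact/slice_CC1_of/ri_propsP. Qed.

(** The integral of a nonnegative function is a supremum over the simple functions below it, so
    monotonicity holds for arbitrary functions. This covers partial integrals whose measurability is
    unknown. *)
Lemma le_integral_nomeas d (T : measurableType d) (mu : {measure set T -> \bar R})
    (F G : T -> \bar R) :
  (forall t, F t <= G t)%E -> (\int[mu]_t F t <= \int[mu]_t G t)%E.
Proof.
move=> FG; rewrite [leLHS]integralE [leRHS]integralE; apply: leeB.
  rewrite !ge0_integralTE//; apply: ge_ereal_sup => _ /= [h hF <-].
  apply: ereal_sup_ubound => /=; exists h => // x.
  by apply: le_trans (hF x) _; rewrite !funeposE ge_max !le_max FG lexx orbT.
rewrite !ge0_integralTE//; apply: ge_ereal_sup => _ /= [h hF <-].
apply: ereal_sup_ubound => /=; exists h => // x.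
by apply: le_trans (hF x) _; rewrite !funenegE ge_max !le_max leeN2 FG lexx orbT.
Qed.

Lemma le_iint n (f g : 'rV[R]_n -> \bar R) : (forall z, (f z <= g z)%E) ->
  (iint f <= iint g)%E.
Proof.
elim: n f g => [|n IH] f g fg /=; first exact: fg.
by apply: le_integral_nomeas => t; apply: IH => v; exact: fg.
Qed.

Lemma iint0 n : iint (fun _ : 'rV[R]_n => 0%E) = 0%E :> \bar R.
Proof. by rewrite (iint_ri (@CC0 n 0)) ri0. Qed.

(** The points whose first coordinate is 0 form a single slice of the outermost integral, hence a
    null set there; on that slice only [0 <= g] is used. *)
Lemma ri_le_iint n M (f : 'rV[R]_n.+1 -> R) (g : 'rV[R]_n.+1 -> \bar R) :
  CC M f -> (forall z : 'rV[R]_n.+1, z 0 0 != 0 -> ((f z)%:E <= g z)%E) ->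
  (forall z, (0 <= g z)%E) -> ((ri f)%:E <= iint g)%E.
Proof.
move=> cf fg g0; rewrite -(iint_ri cf) /=.
set F := (X in (integral _ _ X <= _)%E); set G := (X in (_ <= integral _ _ X)%E).
have G0 t : (0 <= G t)%E by rewrite -(iint0 n); apply: le_iint => v; exact: g0.
have FG t : t != 0 -> (F t <= G t)%E.
  by move=> t0; apply: le_iint => v; apply: fg; rewrite vcons0.
have EF : F = fun t => (ri (fun v : 'rV[R]_n => f (vcons t v)))%:E.
  by apply/funext => t; apply: (iint_ri (CC_slice t cf)).
have iF := CC1_integrable (slice_CC1 cf).
rewrite -(@integral_setD1 R F 0 setT); first last.
- apply: (measurable_funS measurableT) => //.
  by rewrite EF; exact: (measurable_int leb iF).
- exact: measurableD.
rewrite [leLHS]integral_mkcond; apply: le_integral_nomeas => t.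
rewrite /patch; case: ifPn => [/set_mem [_ /= /eqP]|_]; [exact: FG|exact: G0].
Qed.

(** A directional derivative sees only the restriction to a line, so it transfers between different
    spaces along matching lines. *)
Lemma is_derive_line (V1 V2 : normedModType R) (f1 : V1 -> R) (f2 : V2 -> R)
    (z1 e1 : V1) (z2 e2 : V2) (d : R) :
  (forall h, f1 (h *: e1 + z1) = f2 (h *: e2 + z2)) ->
  is_derive z1 e1 f1 d -> is_derive z2 e2 f2 d.
Proof.
move=> H [D1 D2].
have H0 : f1 z1 = f2 z2 by have := H 0; rewrite !scale0r !add0r.
have E : (fun h => h^-1 *: ((f2 \o shift z2) (h *: e2) - f2 z2)) =
         (fun h => h^-1 *: ((f1 \o shift z1) (h *: e1) - f1 z1)).
  by apply/funext => h /=; rewrite -H -H0.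
by split; rewrite /derivable /derive E.
Qed.

Lemma is_derive_cvg (V : normedModType R) (f : V -> R) (z e : V) (d : R) :
  (h^-1 * (f (h *: e + z) - f z)) @[h --> (0 : R)^'] --> d -> is_derive z e f d.
Proof.
move=> H; split; first by apply/cvg_ex; exists d.
exact: cvg_lim.
Qed.

Lemma is_derive1_continuous (f : R -> R) (t d : R) :
  is_derive (t : R^o) 1 f d -> {for t, continuous f}.
Proof. by move=> [D _]; apply: differentiable_continuous; exact/derivable1_diffP. Qed.

Lemma MVT_shift (f f' : R -> R) (a h : R) :
  (forall t, is_derive (t : R^o) 1 f (f' t)) ->
  exists2 c, `|c - a| <= `|h| & f (h + a) - f a = h * f' c.
Proof.
move=> df.
have cf : continuous f by move=> t; exact: is_derive1_continuous (df t).
have MV x y : x <= y -> exists2 c, c \in `[x, y]%R & f y - f x = f' c * (y - x).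
  by move=> xy; apply: MVT_segment => //; exact: continuous_subspaceT.
have [h0|h0] := leP 0 h.
  have [|c] := MV a (h + a); first by rewrite lerDr.
  rewrite in_itv /= => /andP[c1 c2] E; exists c; last by rewrite E; ring.
  rewrite !ger0_norm//; lra.
have [|c] := MV (h + a) a; first by rewrite gerDr ltW.
rewrite in_itv /= => /andP[c1 c2] E; exists c; last first.
  by rewrite -[LHS]opprB E; ring.
rewrite (ltr0_norm h0) ler_norml; lra.
Qed.

Lemma is_derive_vcons0 n (W W' : 'rV[R]_n.+1 -> R) t v :
  is_derive (vcons t v) (delta_mx 0 0) W (W' (vcons t v)) ->
  is_derive (t : R^o) 1 (fun t => W (vcons t v)) (W' (vcons t v)).
Proof.
apply: is_derive_line => h; congr W; apply/rowP => j.
case: (unliftP ord0 j) => [i ->|->].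
  by rewrite vconsS mxE vconsS 2!mxE eqxx /= mulr0 add0r.
by rewrite vcons0 mxE vcons0 2!mxE !eqxx /=.
Qed.

Lemma is_derive_vconsS n (W W' : 'rV[R]_n.+1 -> R) t v i :
  is_derive (vcons t v) (delta_mx 0 (lift ord0 i)) W (W' (vcons t v)) ->
  is_derive v (delta_mx 0 i) (fun v => W (vcons t v)) (W' (vcons t v)).
Proof.
apply: is_derive_line => h; congr W; apply/rowP => j.
case: (unliftP ord0 j) => [l ->|->].
  by rewrite vconsS mxE vconsS 2!mxE mxE [in RHS]mxE mxE eqxx /= (inj_eq lift_inj).
by rewrite vcons0 mxE vcons0 2!mxE /= mulr0 add0r.
Qed.

Lemma CC1_FTC M (F F' : R -> R) : CCfun1 M F -> CCfun1 M F' ->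
  (forall t, is_derive (t : R^o) 1 F (F' t)) -> \int[leb]_t F' t = 0.
Proof.
move=> [cF sF] [cF' sF'] dF.
(* [F] vanishes at [N] and at [- N], whatever the sign of [M]. *)
pose N := `|M| + 1.
have N0 : 0 < N by rewrite ltr_wpDl.
have MN : M < N by rewrite (le_lt_trans (ler_norm M))// ltrDl.
have cF'N : CCfun1 N F' by split=> // t Nt; apply: sF'; exact: lt_trans Nt.
rewrite /Rintegral [X in fine (integral _ _ X)](CC1_itv cF'N) -integral_mkcond.
rewrite (@continuous_FTC2 R F' F)//.
- by rewrite /= !sF ?subrr// ?normrN gtr0_norm.
- lra.
- by apply: continuous_subspaceT => x; exact: cF'.
- split; last 2 first.
  + exact: cvg_at_right_filter (cF _).
  + exact: cvg_at_left_filter (cF _).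
  by move=> t _; case: (dF t).
- by move=> t _; rewrite derive1E; apply: derive_val.
Qed.

(** If the variable is not the outermost one, the inner integrals vanish by induction. Otherwise the
    derivative is taken under the inner integral and the fundamental theorem of calculus is applied
    to the outer one. *)
Lemma ri_pd_eq0 n M (W W' : 'rV[R]_n -> R) i : CC M W -> CC M W' ->
  (forall z, is_derive z (delta_mx 0 i) W (W' z)) -> ri W' = 0.
Proof.
elim: n W W' i => [|n IH] W W' i; first by case: i.
move=> cW cW' dW; case: (unliftP ord0 i) dW => [j ->|->] dW /=.
  rewrite (eq_Rintegral _ (g := fun=> 0)).
    by rewrite Rintegral_cst//= mul0r.
  move=> t _; apply: (IH (fun v => W (vcons t v)) _ j).
  - exact: CC_slice.
  - exact: CC_slice.
  - by move=> v; exact: is_derive_vconsS.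
have dW0 t v := is_derive_vcons0 (dW (vcons t v)).
apply: (@CC1_FTC M (fun t => ri (fun v : 'rV[R]_n => W (vcons t v)))).
- exact: slice_CC1.
- exact: slice_CC1.
move=> t.
(* The difference quotient is completed at h = 0 by the derivative: differentiation under the
   integral becomes continuity of [ri (Q h)] at 0. *)
pose Q (h : R) (v : 'rV[R]_n) : R :=
  if h == 0 then W' (vcons t v) else h^-1 * (W (vcons (h + t) v) - W (vcons t v)).
(* By the mean value theorem the quotient is a value of [W'] on a nearby slice; this yields the
   joint continuity [Qj]. *)
have QE h v : exists2 s, `|s - t| <= `|h| & Q h v = W' (vcons s v).
  rewrite /Q; case: eqVneq => [->|h0].
    by exists t; rewrite // subrr normr0.
  have [c ct E] := @MVT_shift (fun s => W (vcons s v)) _ t h (dW0 ^~ v).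
  by exists c => //; rewrite E mulKf.
have Q0 v : Q 0 v = W' (vcons t v) by rewrite /Q eqxx.
have Qj z : {for (0, z), continuous (fun p : R * 'rV[R]_n => Q p.1 p.2)}.
  apply/cvgrPdist_lt => e e0 /=.
  have : (fun p : R * 'rV[R]_n => W' (vcons p.1 p.2)) @ (t, z) --> W' (vcons t z).
    apply: (@cvg_comp _ _ _ (fun p : R * 'rV[R]_n => vcons p.1 p.2) W'
      _ (nbhs (vcons t z))); last exact: cW'.1.
    by apply: (@cvg_vcons _ _ _ _ fst snd); [exact: cvg_fst|exact: cvg_snd].
  move=> /cvgrPdist_lt /(_ _ e0) [[A B] /= [At Bz] AB].
  have [d /= d0 dA] := (nbhs_ballP _ _).1 At.
  exists (ball 0 d, B) => /=; first by split => //; exact: nbhsx_ballx.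
  move=> [h v] /= [hd Bv]; have [s st ->] := QE h v; rewrite Q0.
  apply: (AB (s, v)); split => //=; apply: dA.
  rewrite /ball /= distrC; apply: le_lt_trans st _.
  by move: hd; rewrite /ball /= sub0r normrN.
have QC h : CC M (Q h).
  rewrite /Q; case: eqVneq => [_|h0]; first exact: CC_slice.
  apply: CCZ; have -> : (fun v => W (vcons (h + t) v) - W (vcons t v)) =
      (fun v => W (vcons (h + t) v) + (-1) * W (vcons t v)).
    by apply/funext => v; rewrite mulN1r.
  by apply: CCD; [|apply: CCZ]; exact: CC_slice.
have Qcvg : ri (Q h) @[h --> (0 : R)] --> ri (Q 0).
  apply: (@ri_param_cvg _ _ _ M) => //.
  by apply: (@filterS _ (nbhs (0 : R)) _ setT) filterT => h _; exact: QC.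
apply: is_derive_cvg.
have <- : ri (Q 0) = ri (fun v : 'rV[R]_n => W' (vcons t v)).
  by congr ri; apply/funext => v; rewrite Q0.
apply: cvg_trans (cvg_trans (cvg_fmap2 (@nbhs_dnbhs _ 0)) Qcvg).
apply: near_eq_cvg; near=> h.
have h0 : h != 0 by near: h; exact: nbhs_dnbhs_neq.
apply: (mulfI h0); rewrite mulVKf// -(riZ h (QC h)).
have -> : ri (fun v : 'rV[R]_n => W (vcons (h%:A + t) v)) =
    ri (fun v => W (vcons t v) + h * Q h v).
  congr ri; apply/funext => v.
  by rewrite /Q (negbTE h0) mulVKf// [RHS]addrC subrK /GRing.scale /= mulr1.
by rewrite (riD (CC_slice t cW) (CCZ h (QC h))) addrAC subrr add0r.
Unshelve. all: by end_near. Qed.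

Lemma ri_le n M (f g : 'rV[R]_n -> R) : CC M f -> CC M g ->
  (forall z, f z <= g z) -> ri f <= ri g.
Proof.
move=> cf cg fg; rewrite -lee_fin -(iint_ri cf) -(iint_ri cg).
by apply: le_iint => z; rewrite lee_fin.
Qed.

Lemma ri_ge0 n M (f : 'rV[R]_n -> R) : CC M f -> (forall z, 0 <= f z) -> 0 <= ri f.
Proof. by move=> cf f0; rewrite -(ri0 n); apply: ri_le cf f0; exact: CC0. Qed.

Lemma CC1_gt0 M (F : R -> R) t0 : CCfun1 M F -> (forall t, 0 <= F t) ->
  0 < F t0 -> 0 < \int[leb]_t F t.
Proof.
move=> cF F0 Ft0.
have c0 : 0 < F t0 / 2 by rewrite divr_gt0.
have /cvgrPdist_lt /(_ _ c0) /nbhs_ballP [d /= d0 dF] := cF.1 t0.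
pose I := `[t0 - d / 2, t0 + d / 2]%classic.
have mI : measurable (I : set R) by exact: measurable_itv.
have iF := CC1_integrable cF.
have : \int[leb]_(t in I) (F t0 / 2) <= \int[leb]_(t in I) F t.
  apply: le_Rintegral => //.
  - apply: continuous_compact_integrable; first exact: segment_compact.
    by apply: continuous_subspaceT => x; exact: cvg_cst.
  - exact: integrableS iF.
  move=> t; rewrite /I /= in_itv /= => /andP[t1 t2].
  have : ball t0 d t by rewrite /ball /= ltr_norml; lra.
  by move=> /dF /=; rewrite ltr_norml; lra.
rewrite Rintegral_cst//= lebesgue_measure_itv /= lte_fin ifT; last lra.
rewrite -EFinB /= => H.
suff : \int[leb]_(t in I) F t <= \int[leb]_t F t.
  apply: lt_le_trans; apply: lt_le_trans H; apply: mulr_gt0 => //; lra.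
rewrite /Rintegral fine_le//.
- by apply: integrable_fin_num => //; exact: integrableS iF.
- exact: integrable_fin_num.
apply: ge0_subset_integral => //.
  exact: (measurable_int leb iF).
by move=> t _; rewrite lee_fin.
Qed.

Lemma ri_gt0 n M (f : 'rV[R]_n -> R) z0 : CC M f -> (forall z, 0 <= f z) ->
  0 < f z0 -> 0 < ri f.
Proof.
elim: n f z0 => [|n IH] f z0 cf f0 fz0 /=; first by rewrite (_ : 0 = z0)//; apply/rowP; case.
apply: (@CC1_gt0 M _ (z0 0 0)); first exact: slice_CC1.
  by move=> t; apply: (ri_ge0 (CC_slice t cf)) => v.
apply: (IH _ (\row_i z0 0 (lift ord0 i)) (CC_slice _ cf)) => //.
by rewrite -vcons_eta.
Qed.

End compactly_supported_integrals.

(** * Rules for directional derivatives *)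

Section derivative_rules.
Variables (R : realType) (V : normedModType R).
Implicit Types (f g : V -> R) (z e : V).

Lemma is_derive_fun_cst (c : R) z e : is_derive z e (fun=> c) 0.
Proof. exact: is_derive_cst. Qed.

Lemma is_derive_fun_add f g z e df dg : is_derive z e f df -> is_derive z e g dg ->
  is_derive z e (fun z => f z + g z) (df + dg).
Proof. exact: is_deriveD. Qed.

Lemma is_derive_fun_mul f g z e df dg : is_derive z e f df -> is_derive z e g dg ->
  is_derive z e (fun z => f z * g z) (df * g z + f z * dg).
Proof.
move=> Df Dg; apply: (is_derive_eq (is_deriveM Df Dg)).
by rewrite /GRing.scale /= addrC (mulrC df).
Qed.

Lemma is_derive_fun_scale c f z e df : is_derive z e f df ->
  is_derive z e (fun z => c * f z) (c * df).
Proof. exact: is_deriveZ. Qed.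

Lemma is_derive_fun_sum n (f : 'I_n -> V -> R) z e (df : 'I_n -> R) :
  (forall i, is_derive z e (f i) (df i)) ->
  is_derive z e (fun z => \sum_(i < n) f i z) (\sum_(i < n) df i).
Proof.
move=> H; rewrite (_ : (fun z => _) = \sum_(i < n) f i); last first.
  by apply/funext => x; rewrite fct_sumE.
exact: is_derive_sum.
Qed.

(** [f] is only known to have a derivative along [e], so the chain rule in one variable is applied
    to its restriction to the line. *)
Lemma is_derive_fun_comp (F : R -> R) f z e dF df :
  is_derive (f z : R^o) 1 F dF -> is_derive z e f df ->
  is_derive z e (fun z => F (f z)) (dF * df).
Proof.
move=> DF Df.
have D1 : is_derive (0 : R^o) 1 (fun h : R => f (h *: e + z)) df.
  by apply: is_derive_line Df => h; rewrite /GRing.scale /= mulr1 addr0.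
have : is_derive (0 : R^o) 1 (F \o (fun h : R => f (h *: e + z))) (dF * df).
  by apply: is_derive1_comp; rewrite scale0r add0r.
by apply: is_derive_line => h /=; rewrite /GRing.scale /= mulr1 addr0.
Qed.

Lemma is_derive_near f g z e d : is_derive z e f d ->
  (\forall x \near z, f x = g x) -> is_derive z e g d.
Proof. by move=> D fg; exact: near_eq_is_derive fg D. Qed.

End derivative_rules.

(** * Real powers of the positive part *)

Section positive_part_powers.
Variable R : realType.
Implicit Types s t : R.

(* Real powers extended by 0 to the negative axis ([powR] takes the value 1
   there, and [0 `^ 0 = 1]). *)
Definition pw s t : R := if 0 < t then t `^ s else 0.

Lemma pwE s t : 0 < t -> pw s t = t `^ s.
Proof. by rewrite /pw => ->. Qed.

Lemma pw_le0 s t : t <= 0 -> pw s t = 0.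
Proof. by rewrite /pw leNgt => /negbTE ->. Qed.

Lemma powR_pw s t : 0 < s -> 0 <= t -> t `^ s = pw s t.
Proof.
move=> s0; rewrite le_eqVlt => /orP[/eqP <-|t0]; last by rewrite pwE.
by rewrite pw_le0// powR0// gt_eqF.
Qed.

Lemma pw_ge0 s t : 0 <= pw s t.
Proof. by rewrite /pw; case: ifP => // _; exact: powR_ge0. Qed.

Lemma pw_gt0 s t : 0 < t -> 0 < pw s t.
Proof. by move=> t0; rewrite pwE// powR_gt0. Qed.

Lemma pwD r s t : pw (r + s) t = pw r t * pw s t.
Proof.
rewrite /pw; case: ifPn => [t0|_]; last by rewrite mul0r.
by rewrite powRD// (gt_eqF t0) implybT.
Qed.

(** Valid at [t = 0] for every sign of [s] because [pw] vanishes there; singular weights are handled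
    through it without splitting cases. *)
Lemma mul_pw s t : 0 <= t -> t * pw s t = pw (s + 1) t.
Proof.
rewrite le_eqVlt => /orP[/eqP <-|t0]; first by rewrite mul0r pw_le0.
by rewrite pwD mulrC [pw 1 t]pwE// powRr1// ltW.
Qed.

Lemma pw_cont_neq0 s t : t != 0 -> {for t, continuous (pw s)}.
Proof.
move=> t0; have [tp|] := ltP 0 t.
  have H : {for t, continuous (fun x => x `^ s)}.
    exact: is_derive1_continuous (is_derive1_powR s tp).
  rewrite /prop_for /continuous_at (pwE s tp); apply: cvg_trans H.
  apply: near_eq_cvg; near=> x; rewrite pwE//.
  by near: x; exact: lt_nbhsr.
rewrite le_eqVlt (negbTE t0) /= => tn.
rewrite /prop_for /continuous_at pw_le0 ?ltW//.
have H : (fun=> 0 : R) x @[x --> t] --> (0 : R) by exact: cvg_cst.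
apply: cvg_trans H.
apply: near_eq_cvg; near=> x; rewrite pw_le0// ltW//.
by near: x; exact: lt_nbhsl.
Unshelve. all: by end_near. Qed.

Lemma pw_continuous s : 0 < s -> continuous (pw s).
Proof.
move=> s0 t; have [->|] := eqVneq t 0; last exact: pw_cont_neq0.
apply/cvgrPdist_lt => e e0; rewrite [pw s 0]pw_le0//; near=> x.
rewrite sub0r normrN ger0_norm ?pw_ge0// /pw; case: ifPn => // x0.
have -> : e = (e `^ (s^-1)) `^ s by rewrite -powRrM mulVf ?gt_eqF// powRr1// ltW.
apply: gt0_ltr_powR => //; rewrite ?nnegrE ?powR_ge0// ?ltW//.
near: x; apply: lt_nbhsl; exact: powR_gt0.
Unshelve. all: by end_near. Qed.

Lemma is_derive_pw_neq0 s t : t != 0 -> is_derive (t : R^o) 1 (pw s) (s * pw (s - 1) t).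
Proof.
move=> t0; have [tp|] := ltP 0 t.
  rewrite (pwE _ tp).
  apply: (is_derive_near (is_derive1_powR s tp)).
  near=> x; rewrite pwE//.
  by near: x; exact: lt_nbhsr.
rewrite le_eqVlt (negbTE t0) /= => tn; rewrite pw_le0 ?ltW// mulr0.
apply: (is_derive_near (is_derive_fun_cst 0 _ _)).
near=> x; rewrite pw_le0// ltW//.
by near: x; exact: lt_nbhsl.
Unshelve. all: by end_near. Qed.

Lemma is_derive_pw s t : 1 < s -> is_derive (t : R^o) 1 (pw s) (s * pw (s - 1) t).
Proof.
move=> s1; have [->|] := eqVneq t 0; last exact: is_derive_pw_neq0.
rewrite [pw (s - 1) 0]pw_le0// mulr0; apply: is_derive_cvg.
(* At 0 the difference quotient of [pw s] is [pw (s - 1)] itself, which tends to 0. *)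
have s10 : 0 < s - 1 by rewrite subr_gt0.
have := pw_continuous s10 (x := 0); rewrite /continuous_at [pw (s - 1) 0]pw_le0// => H.
apply: cvg_trans (cvg_trans (cvg_fmap2 (@nbhs_dnbhs _ 0)) H).
apply: near_eq_cvg; near=> h.
have h0 : h != 0 by near: h; exact: nbhs_dnbhs_neq.
apply: (mulfI h0); rewrite mulVKf// [pw s 0]pw_le0// subr0 addr0 /GRing.scale /= mulr1.
have [hp|hn] := ltP 0 h; last by rewrite !pw_le0// mulr0.
by rewrite mul_pw ?subrK// ltW.
Unshelve. all: by end_near. Qed.

End positive_part_powers.

(** * Pointwise continuity *)

Definition cont_at (T U : topologicalType) (f : T -> U) (z : T) :=
  {for z, continuous f}.

Section pointwise_continuity.
Variables (R : realType) (T : topologicalType).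
Implicit Types (f g : T -> R) (z : T).

Lemma cont_cst (c : R) z : cont_at (fun _ : T => c) z.
Proof. exact: cvg_cst. Qed.

Lemma cont_add f g z : cont_at f z -> cont_at g z ->
  cont_at (fun z => f z + g z) z.
Proof. by move=> cf cg; apply: cvgD. Qed.

Lemma cont_mul f g z : cont_at f z -> cont_at g z ->
  cont_at (fun z => f z * g z) z.
Proof. by move=> cf cg; apply: cvgM. Qed.

Lemma cont_sqr f z : cont_at f z -> cont_at (fun z => f z ^+ 2) z.
Proof. by move=> cf; exact: cont_mul. Qed.

Lemma cont_sum n (f : 'I_n -> T -> R) z : (forall i, cont_at (f i) z) ->
  cont_at (fun z => \sum_(i < n) f i z) z.
Proof.
elim: n f => [|n IH] f cf.
  rewrite (_ : (fun z => _) = (fun=> 0)); first exact: cont_cst.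
  by apply/funext => x; rewrite big_ord0.
rewrite (_ : (fun z => _) = (fun x => f ord0 x + \sum_(i < n) f (lift ord0 i) x)).
  by apply: cont_add; [exact: cf|apply: IH => i; exact: cf].
by apply/funext => x; rewrite big_ord_recl.
Qed.

Lemma cont_comp (U : topologicalType) (F : R -> U) f z :
  cont_at F (f z) -> cont_at f z ->
  cont_at (fun z => F (f z)) z.
Proof. by move=> cF cf; apply: (@continuous_comp _ _ _ f F). Qed.

Lemma cont_near f g z : cont_at f z -> (\forall x \near z, f x = g x) ->
  cont_at g z.
Proof.
move=> cf fg; rewrite /cont_at /prop_for /continuous_at -(nbhs_singleton fg).
by apply: cvg_trans cf; exact: near_eq_cvg.
Qed.

End pointwise_continuity.

(** The folded name [cont_at] gives the goals a head symbol on which this tactic can match. *)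
Ltac cts := repeat lazymatch goal with
  | |- cont_at (fun _ => ?c) _ => exact: cont_cst
  | |- cont_at (fun x => (@?f x + @?g x)%R) _ => apply: (@cont_add _ _ f g)
  | |- cont_at (fun x => (@?f x * @?g x)%R) _ => apply: (@cont_mul _ _ f g)
  | |- cont_at (fun x => (@?f x ^+ 2)%R) _ => apply: (@cont_sqr _ _ f)
  | |- _ => assumption
  end.

(** * Integrands of zero integral *)

Section null_integrands.
Variables (R : realType) (n : nat).
Implicit Types G : 'rV[R]_n -> R.

Definition null (M : R) G := CC M G /\ ri G = 0.

Lemma null_add M G1 G2 : null M G1 -> null M G2 -> null M (fun z => G1 z + G2 z).
Proof.
by move=> [c1 r1] [c2 r2]; split; [exact: CCD|rewrite (riD c1 c2) r1 r2 addr0].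
Qed.

Lemma null_scale M c G : null M G -> null M (fun z => c * G z).
Proof. by move=> [c1 r1]; split; [exact: CCZ|rewrite (riZ c c1) r1 mulr0]. Qed.

Lemma null0 M : null M (fun=> 0).
Proof. by split; [exact: CC0|exact: ri0]. Qed.

Lemma null_sum M p (G : 'I_p -> 'rV[R]_n -> R) : (forall i, null M (G i)) ->
  null M (fun z => \sum_(i < p) G i z).
Proof.
elim: p G => [|p IH] G nG.
  rewrite (_ : (fun z => _) = (fun=> 0)); first exact: null0.
  by apply/funext => x; rewrite big_ord0.
rewrite (_ : (fun z => _) = (fun x => G ord0 x + \sum_(i < p) G (lift ord0 i) x)).
  by apply: null_add; [exact: nG|apply: IH => i; exact: nG].
by apply/funext => x; rewrite big_ord_recl.
Qed.

Lemma null_pd M G G' i : CC M G -> CC M G' ->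
  (forall z, is_derive z (delta_mx 0 i) G (G' z)) -> null M G'.
Proof. by move=> cG cG' dG; split=> //; exact: (ri_pd_eq0 cG cG' dG). Qed.

Lemma near_and_imp (P Q S : 'rV[R]_n -> Prop) (z : 'rV[R]_n) :
  (\forall x \near z, P x) -> (\forall x \near z, Q x) ->
  (forall x, P x -> Q x -> S x) -> \forall x \near z, S x.
Proof.
move=> HP HQ H; have HPQ : nbhs z (P `&` Q) by exact: (@filterI _ _ (rV_filter z) _ _ HP HQ).
by apply: filterS HPQ => x [Px Qx]; exact: H.
Qed.

Lemma derive_near0 (f : 'rV[R]_n -> R) z e d : (\forall x \near z, f x = 0) ->
  is_derive z e f d -> d = 0.
Proof.
move=> f0 D; have [_ <-] : is_derive z e (fun=> 0 : R) d by exact: is_derive_near D f0.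
exact: derive_cst.
Qed.

Lemma near_derive_near0 (f df : 'rV[R]_n -> R) (z e : 'rV[R]_n) : (\forall x \near z, f x = 0) ->
  (forall z, is_derive z e f (df z)) -> \forall x \near z, df x = 0.
Proof.
move=> /near_join f0 D; apply: filterS f0 => x f0x.
exact: derive_near0 f0x (D x).
Qed.

(** Meant for weights that are powers of the gauge: they are singular at most at the origin, near
    which the test function vanishes. *)
Lemma CC_near0 (M : R) (f : 'rV[R]_n -> R) : (forall z, z != 0 -> cont_at f z) ->
  (\forall z \near (0 : 'rV[R]_n), f z = 0) -> (forall z, ~ box M z -> f z = 0) -> CC M f.
Proof.
move=> cf f0 sf; split=> // z; have [->|] := eqVneq z 0; last exact: cf.
apply: (@cont_near _ _ (fun=> 0)); first exact: cont_cst.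
by apply: filterS f0 => x ->.
Qed.

Lemma is_derive_coord z (a b : 'I_n) :
  is_derive z (delta_mx 0 a) (fun z : 'rV[R]_n => z 0 b) ((b == a)%:R).
Proof.
apply: is_derive_cvg.
have H : (fun=> (b == a)%:R : R) h @[h --> (0 : R)^'] --> ((b == a)%:R : R) by exact: cvg_cst.
apply: cvg_trans H; apply: near_eq_cvg; near=> h.
have h0 : h != 0 by near: h; exact: nbhs_dnbhs_neq.
by apply: (mulfI h0); rewrite mulVKf// !mxE eqxx /= addrK.
Unshelve. all: by end_near. Qed.

End null_integrands.

(** * The gauge, the dilation field and its divergence identity *)

Section geometry.
Variables (R : realType) (m k : nat) (gamma : R).
Hypothesis gamma0 : 0 < gamma.
Notation E := 'rV[R]_(m + k).
Notation g := (1 + gamma).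
Notation ex i := (delta_mx 0 (lshift k i) : E).
Notation ey j := (delta_mx 0 (rshift m j) : E).
Implicit Types z : E.

Definition x_coord (i : 'I_m) z := z 0 (lshift k i).
Definition y_coord (j : 'I_k) z := z 0 (rshift m j).
Definition x_sqnorm z := \sum_(i < m) x_coord i z ^+ 2.
Definition y_sqnorm z := \sum_(j < k) y_coord j z ^+ 2.
Definition gauge_pow z := pw g (x_sqnorm z) + g ^+ 2 * y_sqnorm z.
(** Generator of the dilations (x, y) -> (t x, t^g y), for which [gauge_pow] has degree 2 g. It acts
    on a family of candidate partial derivatives, so that manipulating it is pure algebra. *)
Definition euler_op (dF : 'I_(m + k) -> E -> R) z :=
  \sum_(i < m) x_coord i z * dF (lshift k i) z + g * \sum_(j < k) y_coord j z * dF (rshift m j) z.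

Lemma g_gt1 : 1 < g. Proof. by rewrite ltrDl. Qed.
Lemma g_gt0 : 0 < g. Proof. exact: lt_trans g_gt1. Qed.

Lemma usq_ge0 z : 0 <= x_sqnorm z. Proof. by apply: sumr_ge0 => i _; exact: sqr_ge0. Qed.
Lemma vsq_ge0 z : 0 <= y_sqnorm z. Proof. by apply: sumr_ge0 => i _; exact: sqr_ge0. Qed.

Lemma usq_gt0 z i : x_coord i z != 0 -> 0 < x_sqnorm z.
Proof.
move=> zi; rewrite /x_sqnorm (bigD1 i)//= ltr_pwDl//; first by rewrite exprn_even_gt0.
by apply: sumr_ge0 => j _; exact: sqr_ge0.
Qed.

Lemma vsq_gt0 z j : y_coord j z != 0 -> 0 < y_sqnorm z.
Proof.
move=> zi; rewrite /y_sqnorm (bigD1 j)//= ltr_pwDl//; first by rewrite exprn_even_gt0.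
by apply: sumr_ge0 => l _; exact: sqr_ge0.
Qed.

Lemma gauge_ge0 z : 0 <= gauge_pow z.
Proof. by rewrite addr_ge0 ?pw_ge0// mulr_ge0 ?sqr_ge0 ?vsq_ge0. Qed.

Lemma gauge_gt0 z : z != 0 -> 0 < gauge_pow z.
Proof.
move=> z0; have [/existsP[i xi]|] := boolP [exists i, x_coord i z != 0].
  rewrite /gauge_pow ltr_pwDl ?pw_gt0 ?(usq_gt0 xi)//.
  by rewrite mulr_ge0 ?sqr_ge0 ?vsq_ge0.
rewrite negb_exists => /forallP x0.
have [/existsP[j yj]|] := boolP [exists j, y_coord j z != 0].
  rewrite /gauge_pow ltr_wpDl ?pw_ge0// mulr_gt0 ?(vsq_gt0 yj)//.
  by rewrite exprn_gt0 ?g_gt0.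
rewrite negb_exists => /forallP y0; case/eqP: z0; apply/rowP => a; rewrite mxE.
case: (split_ordP a) => [i|j] ->; apply/eqP; apply: negbNE.
  exact: x0.
exact: y0.
Qed.

Lemma cont_xc i z : cont_at (x_coord i) z.
Proof. exact: coord_continuous. Qed.

Lemma cont_yc j z : cont_at (y_coord j) z.
Proof. exact: coord_continuous. Qed.

Lemma cont_usq z : cont_at x_sqnorm z.
Proof. by apply: cont_sum => i; apply: cont_sqr; exact: cont_xc. Qed.

Lemma cont_vsq z : cont_at y_sqnorm z.
Proof. by apply: cont_sum => i; apply: cont_sqr; exact: cont_yc. Qed.

Lemma cont_pw_usq s z : 0 < s -> cont_at (fun z => pw s (x_sqnorm z)) z.
Proof.
move=> s0; apply: (@cont_comp _ _ _ (pw s)); last exact: cont_usq.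
exact: pw_continuous.
Qed.

Lemma cont_gauge z : cont_at gauge_pow z.
Proof.
apply: cont_add; first by apply: cont_pw_usq; exact: g_gt0.
by apply: cont_mul; [exact: cont_cst|exact: cont_vsq].
Qed.

Lemma cont_pw_gauge s z : z != 0 -> cont_at (fun z => pw s (gauge_pow z)) z.
Proof.
move=> z0; apply: (@cont_comp _ _ _ (pw s)); last exact: cont_gauge.
by apply: pw_cont_neq0; rewrite gt_eqF// gauge_gt0.
Qed.

Lemma is_derive_along_cst (f : E -> R) z e : (forall h, f (h *: e + z) = f z) ->
  is_derive z e f 0.
Proof.
move=> fz; apply: (@is_derive_line _ _ _ (fun _ : E => f z) _ z e).
  by move=> h; rewrite fz.
Qed.

Lemma is_derive_xc_x i i' z : is_derive z (ex i) (x_coord i') (i' == i)%:R.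
Proof.
by apply: (is_derive_eq (is_derive_coord z _ _)); rewrite (inj_eq (@lshift_inj _ _)).
Qed.

Lemma is_derive_yc_y j j' z : is_derive z (ey j) (y_coord j') (j' == j)%:R.
Proof.
by apply: (is_derive_eq (is_derive_coord z _ _)); rewrite (inj_eq (@rshift_inj _ _)).
Qed.

Lemma xc_shift_y j i h z : x_coord i (h *: ey j + z) = x_coord i z.
Proof. by rewrite /x_coord !mxE eqxx /= eq_lrshift mulr0 add0r. Qed.

Lemma yc_shift_x i j h z : y_coord j (h *: ex i + z) = y_coord j z.
Proof. by rewrite /y_coord !mxE eqxx /= eq_rlshift mulr0 add0r. Qed.

Lemma usq_shift_y j h z : x_sqnorm (h *: ey j + z) = x_sqnorm z.
Proof. by apply: eq_bigr => i _; rewrite xc_shift_y. Qed.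

Lemma vsq_shift_x i h z : y_sqnorm (h *: ex i + z) = y_sqnorm z.
Proof. by apply: eq_bigr => j _; rewrite yc_shift_x. Qed.

Lemma is_derive_usq i z : is_derive z (ex i) x_sqnorm (2 * x_coord i z).
Proof.
apply: (@is_derive_eq _ _ _ _ _ _ _ (\sum_(i' < m) ((i' == i)%:R * x_coord i' z + x_coord i' z * (i' == i)%:R))).
  apply: is_derive_fun_sum => i'.
  by apply: is_derive_fun_mul; exact: is_derive_xc_x.
rewrite (bigD1 i)//= eqxx mul1r mulr1 big1 ?addr0; first by rewrite mulr_natl.
by move=> l /negbTE ->; rewrite mul0r mulr0 addr0.
Qed.

Lemma is_derive_vsq j z : is_derive z (ey j) y_sqnorm (2 * y_coord j z).
Proof.
apply: (@is_derive_eq _ _ _ _ _ _ _ (\sum_(i' < k) ((i' == j)%:R * y_coord i' z + y_coord i' z * (i' == j)%:R))).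
  apply: is_derive_fun_sum => i'.
  by apply: is_derive_fun_mul; exact: is_derive_yc_y.
rewrite (bigD1 j)//= eqxx mul1r mulr1 big1 ?addr0; first by rewrite mulr_natl.
by move=> l /negbTE ->; rewrite mul0r mulr0 addr0.
Qed.

Lemma is_derive_fx_y (f : R -> R) j z : is_derive z (ey j) (fun z => f (x_sqnorm z)) 0.
Proof. by apply: is_derive_along_cst => h; rewrite usq_shift_y. Qed.

Lemma is_derive_gauge_x i z :
  is_derive z (ex i) gauge_pow (2 * g * pw gamma (x_sqnorm z) * x_coord i z).
Proof.
apply: is_derive_eq.
  apply: is_derive_fun_add.
    apply: is_derive_fun_comp; last exact: is_derive_usq.
    exact: is_derive_pw g_gt1.
  by apply: is_derive_along_cst => h; rewrite vsq_shift_x.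
rewrite (_ : g - 1 = gamma); ring.
Qed.

Lemma is_derive_gauge_y j z : is_derive z (ey j) gauge_pow (2 * g ^+ 2 * y_coord j z).
Proof.
apply: is_derive_eq.
  apply: is_derive_fun_add; first exact: is_derive_fx_y.
  by apply: is_derive_fun_scale; exact: is_derive_vsq.
ring.
Qed.

Lemma is_derive_pw_gauge s e d z : z != 0 -> is_derive z e gauge_pow d ->
  is_derive z e (fun z => pw s (gauge_pow z)) (s * pw (s - 1) (gauge_pow z) * d).
Proof.
move=> z0; apply: is_derive_fun_comp; apply: is_derive_pw_neq0.
by rewrite gt_eqF// gauge_gt0.
Qed.

Lemma mul_usq_pw s z : x_sqnorm z * pw s (x_sqnorm z) = pw (s + 1) (x_sqnorm z).
Proof. by rewrite mul_pw// usq_ge0. Qed.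

Lemma usq_eq0_xc z i : x_sqnorm z = 0 -> x_coord i z = 0.
Proof.
move=> u0; apply/eqP/negPn/negP => /usq_gt0.
by rewrite u0 ltxx.
Qed.

(** Up to the factor 2 gamma, the part of d_i (x_i |x|^(2 gamma)) beyond |x|^(2 gamma). For gamma <
    1 its first factor blows up at x = 0, but the product stays below |x|^(2 gamma). *)
Definition xc2_pw i z := pw (gamma - 1) (x_sqnorm z) * x_coord i z ^+ 2.

Lemma cont_xc2_pw i z : cont_at (xc2_pw i) z.
Proof.
rewrite /xc2_pw.
have [u0|u0] := eqVneq (x_sqnorm z) 0; last first.
  apply: cont_mul; last by apply: cont_sqr; exact: cont_xc.
  apply: (@cont_comp _ _ _ (pw (gamma - 1))); last exact: cont_usq.
  exact: pw_cont_neq0.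
have := @cont_pw_usq gamma z gamma0.
rewrite /cont_at /prop_for /continuous_at u0 !pw_le0// mul0r => H.
apply: (@squeeze_cvgr _ _ _ _ (fun=> 0) (fun z => pw gamma (x_sqnorm z))) => //; last exact: cvg_cst.
near=> x; rewrite mulr_ge0 ?pw_ge0 ?sqr_ge0//=.
rewrite -[gamma in X in _ <= X](subrK 1) -mul_usq_pw mulrC ler_wpM2r ?pw_ge0//.
rewrite /x_sqnorm (bigD1 i)//= lerDl; apply: sumr_ge0 => j _; exact: sqr_ge0.
Unshelve. all: by end_near. Qed.

(** For gamma <= 1 the product rule breaks down at x = 0; there the difference quotient is |x|^(2
    gamma) taken along the line, and it tends to 0. *)
Lemma is_derive_xc_pw i z :
  is_derive z (ex i) (fun z => x_coord i z * pw gamma (x_sqnorm z))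
    (pw gamma (x_sqnorm z) + 2 * gamma * xc2_pw i z).
Proof.
rewrite /xc2_pw.
have [u0|u0] := eqVneq (x_sqnorm z) 0; last first.
  apply: is_derive_eq.
    apply: is_derive_fun_mul; first exact: is_derive_xc_x.
    apply: is_derive_fun_comp; last exact: is_derive_usq.
    exact: is_derive_pw_neq0.
  rewrite eqxx /=; ring.
have H := @cont_pw_usq gamma z gamma0.
rewrite /cont_at /prop_for /continuous_at u0 !pw_le0// in H *.
rewrite mul0r mulr0 addr0; apply: is_derive_cvg.
have S : (fun h : R => h *: ex i + z) @ (0 : R) --> z.
  rewrite -[X in _ --> X](add0r z) -(scale0r (ex i)).
  apply: cvgD; last exact: cvg_cst.
  by apply: cvgZr_tmp; exact: cvg_id.
have := cvg_comp _ _ S H.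
move=> H'; apply: cvg_trans (cvg_trans (cvg_fmap2 (@nbhs_dnbhs _ 0)) H').
apply: near_eq_cvg; near=> h.
have h0 : h != 0 by near: h; exact: nbhs_dnbhs_neq.
apply: (mulfI h0); rewrite mulVKf//= u0 [pw gamma 0]pw_le0// mulr0 subr0.
by congr (_ * _); rewrite /x_coord !mxE !eqxx /= mulr1 -/(x_coord i z) usq_eq0_xc// addr0.
Unshelve. all: by end_near. Qed.

Section euler_identity.
Variables (M : R) (Phi : E -> R) (dPhi : 'I_(m + k) -> E -> R).
Hypothesis cPhi : CC M Phi.
Hypothesis cdPhi : forall a, CC M (dPhi a).
Hypothesis DPhi : forall a z, is_derive z (delta_mx 0 a) Phi (dPhi a z).
Hypothesis Phi0 : \forall z \near (0 : E), Phi z = 0.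

Let dPhi0 a : \forall z \near (0 : E), dPhi a z = 0.
Proof. exact: near_derive_near0 Phi0 (DPhi a). Qed.

(** This integrand is the divergence of [Phi] |x|^(2 gamma) gauge^s times the field (x, g y). The
    field has divergence Q and the two weights have degrees 2 gamma and 2 g s under dilations; these
    add up to the constant. *)
Lemma euler_null s :
  null M (fun z => pw gamma (x_sqnorm z) * pw s (gauge_pow z) * euler_op dPhi z +
    (Qdim m k gamma + 2 * gamma + 2 * g * s) *
       (pw gamma (x_sqnorm z) * pw s (gauge_pow z) * Phi z)).
Proof.
pose Wx i z := Phi z * (x_coord i z * pw gamma (x_sqnorm z) * pw s (gauge_pow z)).
pose Wy j z := Phi z * (pw gamma (x_sqnorm z) * (y_coord j z * pw s (gauge_pow z))).
pose Wx' i z :=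
  dPhi (lshift k i) z * (x_coord i z * pw gamma (x_sqnorm z) * pw s (gauge_pow z)) +
  Phi z * ((pw gamma (x_sqnorm z) + 2 * gamma * xc2_pw i z) * pw s (gauge_pow z)
    + x_coord i z * pw gamma (x_sqnorm z) * (s * pw (s - 1) (gauge_pow z) * (2 * g * pw gamma (x_sqnorm z) * x_coord i z))).
pose Wy' j z :=
  dPhi (rshift m j) z * (pw gamma (x_sqnorm z) * (y_coord j z * pw s (gauge_pow z))) +
  Phi z * (0 * (y_coord j z * pw s (gauge_pow z)) + pw gamma (x_sqnorm z) * ((j == j)%:R * pw s (gauge_pow z) +
     y_coord j z * (s * pw (s - 1) (gauge_pow z) * (2 * g ^+ 2 * y_coord j z)))).
have Nx i : null M (Wx' i).
  apply: (@null_pd _ _ M (Wx i) _ (lshift k i)).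
  - apply: CC_near0.
    + move=> z z0; apply: cont_mul; first exact: cPhi.1.
      apply: cont_mul; last exact: cont_pw_gauge.
      by apply: cont_mul; [exact: cont_xc|exact: cont_pw_usq].
    + by apply: filterS Phi0 => z H; rewrite /Wx H mul0r.
    + by move=> z zM; rewrite /Wx cPhi.2// mul0r.
  - apply: CC_near0.
    + move=> z z0; rewrite /Wx'.
      have cP s' := @cont_pw_gauge s' z z0.
      have cu := @cont_pw_usq gamma z gamma0.
      have cx := @cont_xc i z.
      have c2 := @cont_xc2_pw i z.
      have cF : cont_at Phi z by exact: cPhi.1.
       have cdF : cont_at (dPhi (lshift k i)) z by exact: (cdPhi _).1.
       have cPs := cP s; have cPs1 := cP (s - 1); cts.
    + apply: (near_and_imp Phi0 (dPhi0 (lshift k i))) => z H1 H2.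
      by rewrite /Wx' H1 H2 !mul0r addr0.
    + by move=> z zM; rewrite /Wx' cPhi.2// (cdPhi _).2// !mul0r addr0.
  - move=> z; have [->|z0] := eqVneq z 0.
      rewrite (_ : Wx' i 0 = 0); last first.
        by rewrite /Wx' (nbhs_singleton Phi0) (nbhs_singleton (dPhi0 _)) !mul0r addr0.
      apply: (is_derive_near (is_derive_fun_cst 0 _ _)).
      by apply: filterS Phi0 => x H; rewrite /Wx H mul0r.
    rewrite /Wx /Wx'; apply: (is_derive_fun_mul (DPhi _ _)).
    apply: is_derive_fun_mul; first exact: is_derive_xc_pw.
    by apply: is_derive_pw_gauge => //; exact: is_derive_gauge_x.
have Ny j : null M (Wy' j).
  apply: (@null_pd _ _ M (Wy j) _ (rshift m j)).
  - apply: CC_near0.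
    + move=> z z0; apply: cont_mul; first exact: cPhi.1.
      apply: cont_mul; first exact: cont_pw_usq.
      by apply: cont_mul; [exact: cont_yc|exact: cont_pw_gauge].
    + by apply: filterS Phi0 => z H; rewrite /Wy H mul0r.
    + by move=> z zM; rewrite /Wy cPhi.2// mul0r.
  - apply: CC_near0.
    + move=> z z0; rewrite /Wy'.
      have cP s' := @cont_pw_gauge s' z z0.
      have cu := @cont_pw_usq gamma z gamma0.
      have cx := @cont_yc j z.
      have cF : cont_at Phi z by exact: cPhi.1.
      have cdF : cont_at (dPhi (rshift m j)) z by exact: (cdPhi _).1.
      have cPs := cP s; have cPs1 := cP (s - 1); cts.
    + apply: (near_and_imp Phi0 (dPhi0 (rshift m j))) => z H1 H2.
      by rewrite /Wy' H1 H2 !mul0r addr0.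
    + by move=> z zM; rewrite /Wy' cPhi.2// (cdPhi _).2// !mul0r addr0.
  - move=> z; have [->|z0] := eqVneq z 0.
      rewrite (_ : Wy' j 0 = 0); last first.
        by rewrite /Wy' (nbhs_singleton Phi0) (nbhs_singleton (dPhi0 _)) !mul0r addr0.
      apply: (is_derive_near (is_derive_fun_cst 0 _ _)).
      by apply: filterS Phi0 => x H; rewrite /Wy H mul0r.
    rewrite /Wy /Wy'; apply: (is_derive_fun_mul (DPhi _ _)).
    apply: is_derive_fun_mul; first exact: is_derive_fx_y.
    apply: is_derive_fun_mul; first exact: is_derive_yc_y.
    by apply: is_derive_pw_gauge => //; exact: is_derive_gauge_y.
have := null_add (null_sum Nx) (null_scale g (null_sum Ny)).
congr null; apply/funext => z; rewrite /Wx' /Wy'.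
set b := pw gamma (x_sqnorm z); set c := pw (gamma - 1) (x_sqnorm z).
set A := pw s (gauge_pow z); set B := pw (s - 1) (gauge_pow z).
rewrite (eq_bigr (fun i => b * A * (x_coord i z * dPhi (lshift k i) z) + (Phi z * b * A +
   (Phi z * (2 * gamma * c * A + 2 * g * s * B * b ^+ 2)) * x_coord i z ^+ 2))); last first.
  by move=> i _; rewrite /xc2_pw -/c; ring.
rewrite [X in g * X](eq_bigr (fun j => b * A * (y_coord j z * dPhi (rshift m j) z) + (Phi z * b * A +
   (Phi z * b * (2 * g ^+ 2 * s * B)) * y_coord j z ^+ 2))); last first.
  by move=> j _; rewrite eqxx /=; ring.
rewrite !big_split /= -!mulr_sumr !sumr_const !card_ord -/(x_sqnorm z) -/(y_sqnorm z).
rewrite /euler_op /Qdim.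
set X := \sum_(i < m) _; set Y := \sum_(i < k) _.
(* With these three relations the sums of squares of the x and y coordinates recombine into
   multiples of [b * A]. *)
have Eb : b = x_sqnorm z * c by rewrite /b /c mul_usq_pw subrK.
have EA : A = gauge_pow z * B by rewrite /A /B mul_pw ?subrK ?gauge_ge0.
have EP : gauge_pow z = x_sqnorm z * b + g ^+ 2 * y_sqnorm z.
  by rewrite /gauge_pow /b mul_usq_pw (addrC gamma).
rewrite EA EP Eb -[_ *+ m]mulr_natl -[_ *+ k]mulr_natl; ring.
Qed.

End euler_identity.

End geometry.

(** * The weighted inequality by completion of squares *)

Lemma ri_le_iint_coord (R : realType) n M (i0 : 'I_n) (f : 'rV[R]_n -> R) (G : 'rV[R]_n -> \bar R) :
  i0 = 0 :> nat -> CC M f ->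
  (forall z : 'rV[R]_n, z 0 i0 != 0 -> ((f z)%:E <= G z)%E) ->
  (forall z, (0 <= G z)%E) -> ((ri f)%:E <= iint G)%E.
Proof.
case: n i0 f G => [[]//|n] i0 f G i00 cf fG G0; apply: ri_le_iint cf _ G0 => z z0.
by apply: fG; rewrite (_ : i0 = 0)//; exact: val_inj.
Qed.

Lemma CCM (R : realType) n M (f h : 'rV[R]_n -> R) : CC M f -> continuous h ->
  CC M (fun z => f z * h z).
Proof.
move=> [cf sf] ch; split=> [z|z zM]; last by rewrite sf// mul0r.
by apply: cvgM; [exact: cf|exact: ch].
Qed.

Section hardy_rellich.
Variables (R : realType) (m k : nat) (gamma : R).
Hypothesis gamma0 : 0 < gamma.
Notation E := 'rV[R]_(m + k).
Notation g := (1 + gamma).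
Notation usq := (@x_sqnorm R m k).
Notation vsq := (@y_sqnorm R m k).
Notation gauge := (@gauge_pow R m k gamma).
Notation xc := (@x_coord R m k).
Notation yc := (@y_coord R m k).
Notation euler := (@euler_op R m k gamma).
Implicit Types z : E.

Definition gradsq (dF : 'I_(m + k) -> E -> R) z :=
  \sum_(i < m) dF (lshift k i) z ^+ 2 +
  pw gamma (usq z) * \sum_(j < k) dF (rshift m j) z ^+ 2.

Definition lapl (ddF : 'I_(m + k) -> E -> R) z :=
  \sum_(i < m) ddF (lshift k i) z + pw gamma (usq z) * \sum_(j < k) ddF (rshift m j) z.

Variables (M : R) (F : E -> R) (dF ddF : 'I_(m + k) -> E -> R).
Hypothesis cF : CC M F.
Hypothesis cdF : forall a, CC M (dF a).
Hypothesis cddF : forall a, CC M (ddF a).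
Hypothesis DF : forall a z, is_derive z (delta_mx 0 a) F (dF a z).
Hypothesis DdF : forall a z, is_derive z (delta_mx 0 a) (dF a) (ddF a z).
Hypothesis F0 : \forall z \near (0 : E), F z = 0.

Let dF0 a : \forall z \near (0 : E), dF a z = 0.
Proof. exact: near_derive_near0 F0 (DF a). Qed.

Let c1 z : cont_at F z. Proof. exact: cF.1. Qed.
Let c2 a z : cont_at (dF a) z. Proof. exact: (cdF a).1. Qed.
Let c3 a z : cont_at (ddF a) z. Proof. exact: (cddF a).1. Qed.

(** This is [euler_null] for the square of [F], whose dilation derivative is 2 F E F. *)
Lemma euler_sqr_null s :
  null M (fun z => 2 * (pw gamma (usq z) * pw s (gauge z) * F z * euler dF z) +
    (Qdim m k gamma + 2 * gamma + 2 * g * s) *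
       (pw gamma (usq z) * pw s (gauge z) * F z ^+ 2)).
Proof.
pose d2 a z := dF a z * F z + F z * dF a z.
have := @euler_null R m k gamma gamma0 M (fun z => F z * F z) d2 _ _ _ _ s.
move=> H.
have {}H : null M (fun z => pw gamma (usq z) * pw s (gauge z) * euler d2 z +
    (Qdim m k gamma + 2 * gamma + 2 * g * s) *
       (pw gamma (usq z) * pw s (gauge z) * (F z * F z))).
  apply: H.
  - exact: CCM cF cF.1.
  - by move=> a; apply: CCD; apply: CCM => //; exact: (cdF a).1.
  - by move=> a z; apply: is_derive_fun_mul.
  - by apply: filterS F0 => z ->; rewrite mul0r.
move: H; congr null; apply/funext => z.
suff -> : euler d2 z = 2 * (F z * euler dF z) by rewrite -expr2; ring.
rewrite /euler_op [in RHS]mulrDr mulrCA [X in _ = _ * (_ + X)]mulrCA mulrDr.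
rewrite !mulr_sumr; congr (_ + _).
  by apply: eq_bigr => i _; rewrite /d2; ring.
by apply: eq_bigr => i _; rewrite /d2; ring.
Qed.

(** Green's formula: the divergence of F gauge^s nabla_gamma F. The weight |x|^(2 gamma) of the y
    part depends on x only, hence is not differentiated. *)
Lemma energy_null s :
  null M (fun z => 2 * g * s * (pw gamma (usq z) * pw (s - 1) (gauge z) * F z * euler dF z) +
    pw s (gauge z) * gradsq dF z + pw s (gauge z) * (F z * lapl ddF z)).
Proof.
pose Wx i z := F z * (dF (lshift k i) z * pw s (gauge z)).
pose Wy j z := F z * (pw gamma (usq z) * (dF (rshift m j) z * pw s (gauge z))).
pose Wx' i z := dF (lshift k i) z * (dF (lshift k i) z * pw s (gauge z)) +
  F z * (ddF (lshift k i) z * pw s (gauge z) +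
    dF (lshift k i) z * (s * pw (s - 1) (gauge z) * (2 * g * pw gamma (usq z) * xc i z))).
pose Wy' j z := dF (rshift m j) z * (pw gamma (usq z) * (dF (rshift m j) z * pw s (gauge z))) +
  F z * (0 * (dF (rshift m j) z * pw s (gauge z)) +
   pw gamma (usq z) * (ddF (rshift m j) z * pw s (gauge z) +
     dF (rshift m j) z * (s * pw (s - 1) (gauge z) * (2 * g ^+ 2 * yc j z)))).
have Nx i : null M (Wx' i).
  apply: (@null_pd _ _ M (Wx i) _ (lshift k i)).
  - apply: CC_near0.
    + move=> z z0; rewrite /Wx; have cP := @cont_pw_gauge R m k gamma gamma0 s z z0.
      have h1 := @c1 z; have h2 := @c2 (lshift k i) z; cts.
    + by apply: filterS F0 => z H; rewrite /Wx H mul0r.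
    + by move=> z zM; rewrite /Wx cF.2// mul0r.
  - apply: CC_near0.
    + move=> z z0; rewrite /Wx'.
      have cPs := @cont_pw_gauge R m k gamma gamma0 s z z0.
      have cPs' := @cont_pw_gauge R m k gamma gamma0 (s - 1) z z0.
      have cu := @cont_pw_usq R m k gamma z gamma0.
      have cx := @cont_xc R m k i z.
      have h1 := @c1 z; have h2 := @c2 (lshift k i) z; have h3 := @c3 (lshift k i) z.
      cts.
    + apply: (near_and_imp F0 (dF0 (lshift k i))) => z H1 H2.
      by rewrite /Wx' H1 H2 !mul0r addr0.
    + by move=> z zM; rewrite /Wx' cF.2// (cdF _).2// !mul0r addr0.
  - move=> z; have [->|z0] := eqVneq z 0.
      rewrite (_ : Wx' i 0 = 0); last first.
        by rewrite /Wx' (nbhs_singleton F0) (nbhs_singleton (dF0 _)) !mul0r addr0.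
      apply: (is_derive_near (is_derive_fun_cst 0 _ _)).
      by apply: filterS F0 => x H; rewrite /Wx H mul0r.
    rewrite /Wx /Wx'; apply: (is_derive_fun_mul (DF _ _)).
    apply: (is_derive_fun_mul (DdF _ _)).
    by apply: is_derive_pw_gauge => //; exact: is_derive_gauge_x.
have Ny j : null M (Wy' j).
  apply: (@null_pd _ _ M (Wy j) _ (rshift m j)).
  - apply: CC_near0.
    + move=> z z0; rewrite /Wy; have cP := @cont_pw_gauge R m k gamma gamma0 s z z0.
      have cu := @cont_pw_usq R m k gamma z gamma0.
      have h1 := @c1 z; have h2 := @c2 (rshift m j) z; cts.
    + by apply: filterS F0 => z H; rewrite /Wy H mul0r.
    + by move=> z zM; rewrite /Wy cF.2// mul0r.
  - apply: CC_near0.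
    + move=> z z0; rewrite /Wy'.
      have cPs := @cont_pw_gauge R m k gamma gamma0 s z z0.
      have cPs' := @cont_pw_gauge R m k gamma gamma0 (s - 1) z z0.
      have cu := @cont_pw_usq R m k gamma z gamma0.
      have cy := @cont_yc R m k j z.
      have h1 := @c1 z; have h2 := @c2 (rshift m j) z; have h3 := @c3 (rshift m j) z.
      cts.
    + apply: (near_and_imp F0 (dF0 (rshift m j))) => z H1 H2.
      by rewrite /Wy' H1 H2 !mul0r addr0.
    + by move=> z zM; rewrite /Wy' cF.2// (cdF _).2// !mul0r addr0.
  - move=> z; have [->|z0] := eqVneq z 0.
      rewrite (_ : Wy' j 0 = 0); last first.
        by rewrite /Wy' (nbhs_singleton F0) (nbhs_singleton (dF0 _)) !mul0r addr0.
      apply: (is_derive_near (is_derive_fun_cst 0 _ _)).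
      by apply: filterS F0 => x H; rewrite /Wy H mul0r.
    rewrite /Wy /Wy'; apply: (is_derive_fun_mul (DF _ _)).
    apply: is_derive_fun_mul; first exact: is_derive_fx_y.
    apply: (is_derive_fun_mul (DdF _ _)).
    by apply: is_derive_pw_gauge => //; exact: is_derive_gauge_y.
have := null_add (null_sum Nx) (null_sum Ny).
congr null; apply/funext => z; rewrite /Wx' /Wy'.
set b := pw gamma (usq z).
set A := pw s (gauge z); set B := pw (s - 1) (gauge z).
rewrite (eq_bigr (fun i => A * (dF (lshift k i) z ^+ 2) + (F z * A * ddF (lshift k i) z +
   2 * g * s * B * b * F z * (xc i z * dF (lshift k i) z)))); last first.
  by move=> i _; ring.
rewrite [X in _ + X](eq_bigr (fun j => A * b * dF (rshift m j) z ^+ 2 + (F z * A * b * ddF (rshift m j) z +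
   2 * g ^+ 2 * s * B * b * F z * (yc j z * dF (rshift m j) z)))); last first.
  by move=> j _; ring.
rewrite !big_split /= -!mulr_sumr.
rewrite /gradsq /lapl /euler_op -/b; ring.
Qed.

(** The right-hand side is |nabla_gamma F + c nabla_gamma gauge / (2 g)|^2; its expansion rests on
    |nabla_gamma gauge|^2 = 4 g^2 |x|^(2 gamma) gauge. *)
Lemma gradsq_square c z :
  gradsq dF z + 2 * c * pw gamma (usq z) * euler dF z +
    c ^+ 2 * pw gamma (usq z) * gauge z =
  \sum_(i < m) (dF (lshift k i) z + c * pw gamma (usq z) * xc i z) ^+ 2 +
  pw gamma (usq z) * \sum_(j < k) (dF (rshift m j) z + c * g * yc j z) ^+ 2.
Proof.
set b := pw gamma (usq z).
rewrite [X in _ = X + _](eq_bigr (fun i => dF (lshift k i) z ^+ 2 +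
  (2 * c * b * (xc i z * dF (lshift k i) z) + (c * b) ^+ 2 * xc i z ^+ 2))); last first.
  by move=> i _; ring.
rewrite [X in _ = _ + _ * X](eq_bigr (fun j => dF (rshift m j) z ^+ 2 +
  (2 * c * g * (yc j z * dF (rshift m j) z) + (c * g) ^+ 2 * yc j z ^+ 2))); last first.
  by move=> i _; ring.
rewrite !big_split /= -!mulr_sumr -/(usq z) -/(vsq z).
rewrite /gradsq /euler_op /gauge_pow -/b.
rewrite (_ : pw g (usq z) = usq z * b); last by rewrite /b mul_usq_pw addrC.
ring.
Qed.

Lemma CC_weighted_gradsq s : CC M (fun z => pw s (gauge z) * gradsq dF z).
Proof.
apply: CC_near0.
- move=> z z0; have cPs := @cont_pw_gauge R m k gamma gamma0 s z z0.
  have cu := @cont_pw_usq R m k gamma z gamma0.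
  rewrite /gradsq; apply: cont_mul => //; apply: cont_add.
    by apply: cont_sum => i; apply: cont_sqr; exact: c2.
  apply: cont_mul => //.
  by apply: cont_sum => i; apply: cont_sqr; exact: c2.
- have : \forall z \near (0 : E), forall a, dF a z = 0.
    exact: (@filter_forall _ _ _ _ (rV_filter (0 : E)) dF0).
  apply: filterS => z H; rewrite /gradsq !big1 ?mulr0 ?addr0 ?mulr0//.
    by move=> j _; rewrite H expr0n.
  by move=> j _; rewrite H expr0n.
- move=> z zM; rewrite /gradsq !big1 ?mulr0 ?addr0 ?mulr0//.
    by move=> j _; rewrite (cdF _).2// expr0n.
  by move=> j _; rewrite (cdF _).2// expr0n.
Qed.

(** [L] is prescribed only where the first coordinate is nonzero, so the value given to the quotient
    on x = 0 does not matter, and its integral may be infinite. *)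
Lemma hardy_rellich (b : R) (L : E -> R) (i0 : 'I_m) :
  i0 = 0 :> nat -> 0 < b -> b + 2 < Qdim m k gamma ->
  (forall z, 0 <= L z) ->
  (forall z, xc i0 z != 0 ->
    L z = pw (b / (2 * g) + 1) (gauge z) * lapl ddF z ^+ 2 / pw gamma (usq z)) ->
  (((Qdim m k gamma - (b + 2)) ^+ 2 / 4 *
     ri (fun z => (pw (b / (2 * g)) (gauge z) * gradsq dF z) : R))%:E <=
   iint (fun z => (L z)%:E))%E.
Proof.
move=> i00 b0; set Q := Qdim m k gamma => bQ L0 LE.
set be := b / (2 * g).
(* [a] is the constant of [euler_sqr_null] at the exponent [be - 1], and gauge^(- a / (4 g)) is the
   virtual extremal f. [la] is its eigenvalue: Delta_gamma f = - la |x|^(2 gamma) f / gauge. *)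
pose a := Q + b - 2; pose q := Q - (b + 2).
pose la := a * q / 4; pose ka := q ^+ 2 / 4; pose mu := - (a ^+ 2 * q / 8).
have N1 := energy_null be; have N2 := euler_sqr_null (be - 1).
have cD := CC_weighted_gradsq be.
rewrite -/ka -(riZ _ cD).
have g0 : g != 0 by rewrite gt_eqF// (g_gt0 gamma0).
have Eb : 2 * g * be = b by rewrite /be; field.
set D := fun z => pw be (gauge z) * gradsq dF z.
(* The factor [- 2 * la] produces the cross term of the square in the Laplacian; [mu] is then forced
   by the terms in F E F. *)
have NN := null_add (null_scale (- 2 * la) N1) (null_scale mu N2).
rewrite -[X in (X)%:E]addr0 -NN.2 -(riD (CCZ _ cD) NN.1).
have cc := CCD (CCZ ka cD) NN.1.
apply: (ri_le_iint_coord (i0 := lshift k i0) _ cc) => //.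
move=> z z0; rewrite lee_fin (LE _ z0).
have u0 : 0 < usq z by exact: (@usq_gt0 R m k z i0 z0).
have P0 : 0 < gauge z.
  by apply: gauge_gt0 => //; apply: contraNneq z0 => ->; rewrite mxE.
(* With this coefficient the first order squares vanish on the virtual extremal. *)
have := gradsq_square (a * F z / (2 * gauge z)) z.
set S := (X in _ = X) => HS.
have S0 : 0 <= S.
  rewrite /S addr_ge0 ?sumr_ge0// => [i _|]; first exact: sqr_ge0.
  by rewrite mulr_ge0 ?pw_ge0 ?sumr_ge0// => j _; exact: sqr_ge0.
have B0 := pw_gt0 (be - 1) P0; have w0 := pw_gt0 gamma u0.
have EA : pw be (gauge z) = gauge z * pw (be - 1) (gauge z).
  by rewrite mul_pw ?subrK// ltW.
have EA1 : pw (be + 1) (gauge z) = gauge z ^+ 2 * pw (be - 1) (gauge z).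
  by rewrite expr2 -mulrA -EA mul_pw// ltW.
rewrite /D EA EA1 Eb -/Q.
have -> : Q + 2 * gamma + 2 * g * (be - 1) = a.
  by rewrite mulrBr Eb /a; ring.
set P := gauge z in P0 HS *; set B := pw (be - 1) P in B0 *.
set w := pw gamma (usq z) in w0 HS *.
set G := gradsq dF z in HS *; set e := euler dF z in HS *.
set l := lapl ddF z; set f := F z in HS *.
rewrite -subr_ge0.
have -> : P ^+ 2 * B * l ^+ 2 / w -
   (ka * (P * B * G) + (- 2 * la * (b * (w * B * f * e) + P * B * G + P * B * (f * l)) +
     mu * (2 * (w * B * f * e) + a * (w * B * f ^+ 2)))) =
   B / w * (P * l + la * w * f) ^+ 2 + q * (a + 2 * b) / 4 * (P * B * S).
  rewrite -HS /ka /la /mu (_ : q = a - 2 * b); last by rewrite /q /a; ring.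
  by field; rewrite !gt_eqF.
have q0 : 0 < q by rewrite subr_gt0.
have a0 : 0 < a by rewrite /a; lra.
apply: addr_ge0; first by rewrite mulr_ge0 ?sqr_ge0// divr_ge0// ltW.
apply: mulr_ge0; last by rewrite !mulr_ge0// ltW.
by rewrite divr_ge0// mulr_ge0// ?ltW// addr_gt0 ?mulr_gt0.
Qed.

End hardy_rellich.

(** * Regularity and support of test functions *)

Section admissible_functions.
Variables (R : realType) (n : nat).
Implicit Types (f : 'rV[R]_n -> R) (K : set 'rV[R]_n).

(** Iterated derivatives of [pd a f] are those of [f] along words ending in [a]. *)
Lemma smooth_pd f a : smooth f -> smooth (pd a f).
Proof. by move=> sf s z; have := sf (rcons s a) z; rewrite foldr_rcons. Qed.

Lemma smooth_is_derive f a z : smooth f -> is_derive z (delta_mx 0 a) f (pd a f z).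
Proof. by move=> sf; apply: DeriveDef => //; apply: diff_derivable; exact: (sf [::]). Qed.

Lemma smooth_continuous f : smooth f -> continuous f.
Proof. by move=> sf z; apply: differentiable_continuous; exact: (sf [::]). Qed.

Lemma compact_near K z : compact K -> ~ K z -> \forall x \near z, ~ K x.
Proof.
move=> cK Kz; apply: open_nbhs_nbhs; split => //.
apply: closed_openC; apply: compact_closed => //; exact: norm_hausdorff.
Qed.

Lemma compact_box K : compact K -> exists M, forall z, ~ box M z -> ~ K z.
Proof.
move=> /compact_bounded [M [_ KM]]; exists (M + 1) => z zM Kz; apply: zM => i.
apply: le_trans (KM (M + 1) _ z Kz); last by rewrite ltrDl.
have -> : `|z| = mx_norm z by [].
by rewrite mx_normrE; apply: (le_bigmax _ (fun i : 'I_1 * 'I_n => `|z i.1 i.2|) (0, i)).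
Qed.

Lemma pd_supp f a K : smooth f -> compact K -> (forall z, ~ K z -> f z = 0) ->
  forall z, ~ K z -> pd a f z = 0.
Proof.
move=> sf cK fK z zK; apply: (@derive_near0 _ _ f z (delta_mx 0 a)); last exact: smooth_is_derive.
by apply: filterS (compact_near cK zK) => x; exact: fK.
Qed.

Lemma admissible_CC f : admissible f -> exists M,
  [/\ CC M f, (forall a, CC M (pd a f)), (forall a, CC M (pd a (pd a f))) &
      \forall z \near (0 : 'rV[R]_n), f z = 0].
Proof.
move=> [sf [K [cK [K0 fK]]]]; have [M HM] := compact_box cK; exists M.
have sd a := smooth_pd a sf; have sdd a := smooth_pd a (sd a).
have dK a := pd_supp a sf cK fK; have ddK a := pd_supp a (sd a) cK (dK a).
split.
- by split; [exact: smooth_continuous|move=> z /HM /fK].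
- by move=> a; split; [exact: smooth_continuous|move=> z /HM /dK].
- by move=> a; split; [exact: smooth_continuous|move=> z /HM /ddK].
- by apply: filterS (compact_near cK K0) => x; exact: fK.
Qed.

End admissible_functions.

(** * The integrands of the statement in terms of the gauge *)

Section grushin_quantities.
Variables (R : realType) (m k : nat) (gamma : R).
Hypothesis gamma0 : 0 < gamma.
Notation E := 'rV[R]_(m + k).
Notation g := (1 + gamma).
Notation usq := (@x_sqnorm R m k).
Notation vsq := (@y_sqnorm R m k).
Notation gauge := (@gauge_pow R m k gamma).
Notation xc := (@x_coord R m k).
Notation yc := (@y_coord R m k).
Implicit Types (z : E) (f : E -> R).

Lemma enorm_xpart z : enorm (xpart z) = usq z `^ 2^-1.
Proof.
rewrite /enorm powR12_sqrt ?usq_ge0//; congr Num.sqrt.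
by apply: eq_bigr => i _; rewrite /xpart mxE.
Qed.

Lemma enorm_ypart z : enorm (ypart z) ^+ 2 = vsq z.
Proof.
rewrite /enorm sqr_sqrtr; last by apply: sumr_ge0 => i _; exact: sqr_ge0.
by apply: eq_bigr => i _; rewrite /ypart mxE.
Qed.

Lemma xw_sqr z : xw gamma z ^+ 2 = pw gamma (usq z).
Proof.
rewrite /xw enorm_xpart -powR_mulrn ?powR_ge0// -!powRrM.
by rewrite -powR_pw ?usq_ge0//; congr (_ `^ _); field.
Qed.

Lemma rhoE z : rho gamma z = gauge z `^ (1 / (2 * g)).
Proof.
rewrite /rho enorm_xpart enorm_ypart -powRrM; congr ((_ + _) `^ _).
by rewrite -powR_pw ?usq_ge0 ?g_gt0//; congr (_ `^ _); field.
Qed.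

Lemma rho_powR s z : 0 < s -> rho gamma z `^ s = pw (s / (2 * g)) (gauge z).
Proof.
move=> s0; rewrite rhoE -powRrM mulrAC mul1r powR_pw ?gauge_ge0//.
by rewrite divr_gt0// mulr_gt0// g_gt0.
Qed.

Lemma grad_gamma_sqE f z : grad_gamma_sq gamma f z = gradsq gamma (fun a => pd a f) z.
Proof.
rewrite /grad_gamma_sq /gradsq; congr (_ + _).
by rewrite -xw_sqr mulr_sumr; apply: eq_bigr => j _; rewrite exprMn.
Qed.

Lemma grushinE f z : grushin gamma f z = lapl gamma (fun a => pd a (pd a f)) z.
Proof. by rewrite /grushin /lapl xw_sqr. Qed.

(** The last factor is rho^(- 2 gamma). *)
Lemma grad_gamma_sq_rho z : z != 0 ->
  grad_gamma_sq gamma (rho gamma) z = pw gamma (usq z) * pw (g^-1 - 1) (gauge z).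
Proof.
move=> z0; rewrite grad_gamma_sqE.
have P0 : 0 < gauge z by exact: gauge_gt0.
set s := 1 / (2 * g); have s0 : 0 < s by rewrite divr_gt0// mulr_gt0// g_gt0.
have ER : rho gamma = fun z : E => pw s (gauge z).
  by apply/funext => x; rewrite rhoE powR_pw ?gauge_ge0.
have Dx i : pd (lshift k i) (rho gamma) z =
    s * pw (s - 1) (gauge z) * (2 * g * pw gamma (usq z) * xc i z).
  by rewrite /pd ER; apply: derive_val; apply: is_derive_pw_gauge => //; exact: is_derive_gauge_x.
have Dy j : pd (rshift m j) (rho gamma) z =
    s * pw (s - 1) (gauge z) * (2 * g ^+ 2 * yc j z).
  by rewrite /pd ER; apply: derive_val; apply: is_derive_pw_gauge => //; exact: is_derive_gauge_y.
set B := pw (s - 1) (gauge z) in Dx Dy *; set b := pw gamma (usq z) in Dx *.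
rewrite /gradsq (eq_bigr (fun i => (s * B * (2 * g * b)) ^+ 2 * xc i z ^+ 2)); last first.
  by move=> i _; rewrite Dx; ring.
rewrite [X in _ + _ * X](eq_bigr (fun j => (s * B * (2 * g ^+ 2)) ^+ 2 * yc j z ^+ 2)); last first.
  by move=> j _; rewrite Dy; ring.
rewrite -!mulr_sumr -/(usq z) -/(vsq z) -/b.
have EP : gauge z = usq z * b + g ^+ 2 * vsq z.
  by rewrite /gauge_pow /b mul_usq_pw (addrC gamma).
have -> : pw (g^-1 - 1) (gauge z) = gauge z * (B * B).
  rewrite -pwD mul_pw ?gauge_ge0//; congr (pw _ _).
  by rewrite /s; field; rewrite gt_eqF// g_gt0.
rewrite EP (_ : s * B * (2 * g * b) = B * b); last first.
  by rewrite /s; field; rewrite gt_eqF// g_gt0.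
rewrite (_ : s * B * (2 * g ^+ 2) = B * g); last first.
  by rewrite /s; field; rewrite gt_eqF// g_gt0.
ring.
Qed.

Section integrals.
Variable alpha : R.
Hypothesis alpha2 : 2 < alpha.
Let alpha0 : 0 < alpha. Proof. exact: lt_trans alpha2. Qed.
Let be := (alpha - 2) / (2 * g).

Definition lhs_integrand f z :=
  rho gamma z `^ alpha * (grushin gamma f z) ^+ 2 / grad_gamma_sq gamma (rho gamma) z.

Lemma lhs_integrand_ge0 f z : 0 <= lhs_integrand f z.
Proof.
rewrite /lhs_integrand mulr_ge0//; first by rewrite mulr_ge0 ?powR_ge0 ?sqr_ge0.
rewrite invr_ge0 /grad_gamma_sq addr_ge0// sumr_ge0// => i _; exact: sqr_ge0.
Qed.

(** The weight becomes rho^(alpha + 2 gamma) / |x|^(2 gamma). On x = 0 both sides are divisions by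
    zero, hence 0. *)
Lemma lhs_integrandE f z : z != 0 -> lhs_integrand f z =
  pw (be + 1) (gauge z) * lapl gamma (fun a => pd a (pd a f)) z ^+ 2 / pw gamma (usq z).
Proof.
move=> z0; rewrite /lhs_integrand grushinE grad_gamma_sq_rho// rho_powR//.
have P0 : 0 < gauge z by exact: gauge_gt0.
have -> : pw (alpha / (2 * g)) (gauge z) = pw (be + 1) (gauge z) * pw (g^-1 - 1) (gauge z).
  rewrite -pwD; congr (pw _ _); rewrite /be.
  by field; rewrite gt_eqF// g_gt0.
have B0 : pw (g^-1 - 1) (gauge z) != 0 by rewrite gt_eqF// pw_gt0.
rewrite invfM; set B := pw (g^-1 - 1) _ in B0 *.
set A := pw (be + 1) _; set l := lapl _ _ _; set b := (pw gamma _)^-1.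
transitivity (A * l ^+ 2 * b * (B * B^-1)); first by ring.
by rewrite divff// mulr1.
Qed.

Lemma lhs_integrand_at0 f : lhs_integrand f 0 = 0.
Proof.
rewrite /lhs_integrand rho_powR//.
rewrite (_ : gauge 0 = 0) ?pw_le0 ?mul0r// /gauge_pow /y_sqnorm /x_sqnorm.
by rewrite !big1 ?mulr0 ?pw_le0 ?addr0// => i _; rewrite /x_coord /y_coord mxE expr0n.
Qed.

Lemma den_integrandE f z : rho gamma z `^ (alpha - 2) * grad_gamma_sq gamma f z =
  pw be (gauge z) * gradsq gamma (fun a => pd a f) z.
Proof. by rewrite grad_gamma_sqE rho_powR// subr_gt0. Qed.

Lemma rhs_integrandE f z : rho gamma z `^ alpha * grad_gamma_sq gamma f z / rho gamma z ^+ 2 =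
  pw be (gauge z) * gradsq gamma (fun a => pd a f) z.
Proof.
rewrite grad_gamma_sqE -powR_mulrn ?rho_powR//; last by rewrite rhoE powR_ge0.
rewrite mulrAC; congr (_ * _).
have [P0|P0] := ltP 0 (gauge z); last by rewrite !pw_le0// mul0r.
rewrite (_ : alpha / (2 * g) = be + 2 / (2 * g)); last first.
  by rewrite /be; field; rewrite gt_eqF// g_gt0.
by rewrite pwD mulfK// gt_eqF// pw_gt0.
Qed.

Lemma den_int_ri f : admissible f ->
  den_int gamma alpha f =
  (ri (fun z => (pw be (gauge z) * gradsq gamma (fun a => pd a f) z) : R))%:E.
Proof.
move=> af; have [M [c1 c2 c3 f0]] := admissible_CC af.
have cD := CC_weighted_gradsq gamma0 c2 (fun a z => smooth_is_derive a z af.1) f0 be.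
rewrite -(iint_ri cD) /den_int; congr iint; apply/funext => z.
by rewrite den_integrandE.
Qed.

Lemma rhs_int_den_int f : rhs_int gamma alpha f = den_int gamma alpha f.
Proof.
rewrite /rhs_int /den_int; congr iint; apply/funext => z.
by rewrite den_integrandE rhs_integrandE.
Qed.

Lemma hardy_rellich_admissible f : (0 < m)%N -> alpha < Qdim m k gamma -> admissible f ->
  (((Qdim m k gamma - alpha) ^+ 2 / 4)%:E * den_int gamma alpha f <= lhs_int gamma alpha f)%E.
Proof.
move=> m0 aQ af; have [M [c1 c2 c3 f0]] := admissible_CC af.
rewrite den_int_ri// -EFinM.
rewrite (_ : (Qdim m k gamma - alpha) = Qdim m k gamma - ((alpha - 2) + 2)); last by rewrite subrK.
apply: (hardy_rellich gamma0 c1 c2 c3 _ _ f0 (i0 := Ordinal m0)) => //.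
- by move=> a z; exact: smooth_is_derive af.1.
- by move=> a z; apply: smooth_is_derive; exact: smooth_pd af.1.
- by rewrite subr_gt0.
- by rewrite subrK.
- exact: lhs_integrand_ge0.
- move=> z z0; apply: lhs_integrandE.
  by apply: contraNneq z0 => ->; rewrite /x_coord mxE.
Qed.

(** A compactly supported function whose derivative along the first x direction vanishes everywhere
    is 0, and that direction carries no degenerate weight in the gradient. *)
Lemma den_int_gt0 f z0 : (0 < m)%N -> admissible f -> f z0 != 0 ->
  (0 < den_int gamma alpha f)%E.
Proof.
move=> m0 af fz0; have [M [c1 c2 c3 f0]] := admissible_CC af.
have df a z := smooth_is_derive a z af.1.
rewrite den_int_ri// lte_fin.
have cD := CC_weighted_gradsq gamma0 c2 df f0 be.
pose a := lshift k (Ordinal m0).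
have [z dz] : exists z, pd a f z != 0.
  (* A shift of [z0] by [N] along [a] leaves the box. *)
  pose N := `|M| + `|z0 0 a| + 1.
  have D1 t : is_derive (t : R^o) 1 (fun t : R => f (t *: delta_mx 0 a + z0))
      (pd a f (t *: delta_mx 0 a + z0)).
    apply: is_derive_line (df a _) => h.
    by rewrite addrA -scalerDl /GRing.scale /= mulr1.
  have [c _] := @MVT_shift _ _ _ 0 N D1.
  rewrite addr0 scale0r add0r (c1.2 (N *: _ + _)); last first.
    move=> /(_ a); rewrite !mxE !eqxx /= mulr1; apply/negP; rewrite -ltNge /N.
    have h1 := ler_norm M; have h2 := ler_norm (- z0 0 a).
    rewrite normrN in h2; apply: lt_le_trans (ler_norm _); lra.
  move=> H; exists (c *: delta_mx 0 a + z0); apply: contraNneq fz0 => H0.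
  by move: H; rewrite H0 mulr0 sub0r => /eqP; rewrite oppr_eq0.
have z00 : z != 0.
  apply: contraNneq dz => ->; apply/eqP.
  exact: (derive_near0 f0 (df a 0)).
apply: (@ri_gt0 _ _ M _ z) => //.
  move=> x; rewrite mulr_ge0 ?pw_ge0// addr_ge0 ?sumr_ge0// => [i _|]; first exact: sqr_ge0.
  by rewrite mulr_ge0 ?pw_ge0 ?sumr_ge0// => i _; exact: sqr_ge0.
rewrite mulr_gt0 ?pw_gt0 ?gauge_gt0// /gradsq (bigD1 (Ordinal m0))//= -addrA ltr_pwDl//.
  by rewrite exprn_even_gt0.
rewrite addr_ge0 ?sumr_ge0// => [i _|]; first exact: sqr_ge0.
by rewrite mulr_ge0 ?pw_ge0 ?sumr_ge0// => i _; exact: sqr_ge0.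
Qed.

End integrals.
End grushin_quantities.

(** * Smooth functions of one variable *)

Section smooth_generators.
Variable R : realType.
Implicit Types (s e d t x : R) (f : R -> R).

(* The flat factor [exp (- e / t)] makes every derivative at 0 vanish, whatever
   the power [s]. *)
Definition gexp s e t : R := pw s t * expR (- (e / t)).

(* [p ^ s * f (d * ln p)]: differentiation in [p] stays in this class, lowering
   [s] by one and replacing [f] by [s * f + d * f']. *)
Definition logpow s d f t : R := pw s t * f (d * ln t).

Lemma gexp_le0 s e t : t <= 0 -> gexp s e t = 0.
Proof. by move=> t0; rewrite /gexp pw_le0// mul0r. Qed.

Lemma logpow_le0 s d f t : t <= 0 -> logpow s d f t = 0.
Proof. by move=> t0; rewrite /logpow pw_le0// mul0r. Qed.

Lemma expRN_le x : 0 < x -> expR (- x) <= x^-1.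
Proof.
move=> x0; rewrite expRN lef_pV2 ?posrE ?expR_gt0//.
by apply: le_trans (expR_ge1Dx x); rewrite lerDr.
Qed.

Lemma gexp_bound s e (N : nat) t : 0 < e ->
  gexp s e t <= (N.+1%:R / e) ^+ N.+1 * pw (s + N.+1%:R) t.
Proof.
move=> e0; have [t0|t0] := ltP 0 t; last by rewrite gexp_le0// pw_le0// mulr0.
have N0 : 0 < N.+1%:R :> R by rewrite ltr0n.
rewrite /gexp pwD mulrCA ler_wpM2l ?pw_ge0// [pw N.+1%:R t]pwE// powR_mulrn ?(ltW t0)//.
(* This uses exp (- x) = (exp (- x / n))^n <= (n / x)^n with x = e / t and n = N + 1. *)
have -> : - (e / t) = N.+1%:R * - (e / t / N.+1%:R).
  by field; rewrite !gt_eqF.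
rewrite expRM_natl -exprMn ler_pXn2r ?nnegrE ?expR_ge0//; last first.
  by rewrite mulr_ge0 ?divr_ge0 ?ltW.
have x0 : 0 < e / t / N.+1%:R by rewrite !divr_gt0.
apply: le_trans (expRN_le x0) _; rewrite le_eqVlt; apply/orP; left; apply/eqP.
by field; rewrite !gt_eqF.
Qed.

Lemma gexp_ge0 s e t : 0 <= gexp s e t.
Proof. by rewrite mulr_ge0 ?pw_ge0 ?expR_ge0. Qed.

Lemma gexp_cvg0 s e : 0 < e -> gexp s e t @[t --> (0 : R)] --> (0 : R).
Proof.
(* [N] is so large that the power of [t] in the bound has a positive exponent. *)
move=> e0; pose N := Num.bound `|s|.
have sN : 0 < s + N.+1%:R.
  have := archi_boundP (normr_ge0 s); rewrite -/N => h.
  have := ler_norm (- s); rewrite normrN -natr1; lra.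
apply: (@squeeze_cvgr _ _ _ _ (fun=> 0)
  (fun t => (N.+1%:R / e) ^+ N.+1 * pw (s + N.+1%:R) t)).
- by near=> t; rewrite gexp_ge0 gexp_bound.
- exact: cvg_cst.
have := @pw_continuous _ _ sN 0; rewrite /continuous_at pw_le0// => H.
rewrite -[X in _ --> X](mulr0 ((N.+1%:R / e) ^+ N.+1)).
by apply: cvgM; [exact: cvg_cst|exact: H].
Unshelve. all: by end_near. Qed.

Lemma is_derive_gexp s e t : 0 < e ->
  is_derive (t : R^o) 1 (gexp s e) (s * gexp (s - 1) e t + e * gexp (s - 2) e t).
Proof.
move=> e0; have [->|t0] := eqVneq t 0.
  rewrite !gexp_le0// !mulr0 addr0; apply: is_derive_cvg.
  (* At 0 the difference quotient of [gexp s e] is [gexp (s - 1) e]. *)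
  have H := @gexp_cvg0 (s - 1) e e0.
  apply: cvg_trans (cvg_trans (cvg_fmap2 (@nbhs_dnbhs _ 0)) H).
  apply: near_eq_cvg; near=> h.
  have h0 : h != 0 by near: h; exact: nbhs_dnbhs_neq.
  apply: (mulfI h0); rewrite mulVKf// [gexp s e 0]gexp_le0// subr0 addr0 /GRing.scale /= mulr1.
  have [hp|hn] := ltP 0 h; last by rewrite !gexp_le0// mulr0.
  by rewrite /gexp mulrA mul_pw ?ltW// subrK.
have D : is_derive (t : R^o) 1 (fun t : R => - (e / t)) (e / t ^+ 2).
  have D1 : is_derive (t : R^o) 1 (fun t : R => t^-1) (- t ^- 2).
    by apply: is_derive_eq; first exact: is_deriveV; rewrite /GRing.scale /= mulr1.
  have D2 := is_derive_fun_scale (- e) D1.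
  rewrite (_ : e / t ^+ 2 = - e * - t ^- 2); last by rewrite mulrNN.
  by rewrite (_ : (fun _ => _) = (fun t : R => - e * t^-1))//; apply/funext => x; rewrite mulNr.
apply: (is_derive_eq (is_derive_fun_mul (is_derive_pw_neq0 s t0)
  (is_derive_fun_comp (is_derive_expR _) D))).
rewrite /gexp; have [tp|tn] := ltP 0 t; last by rewrite !pw_le0//; ring.
rewrite (_ : s - 2 = (s - 1) - 1); last by ring.
rewrite -[pw s t](_ : t * pw (s - 1) t = _); last by rewrite mul_pw ?subrK// ltW.
rewrite -[pw (s - 1) t](_ : t * pw (s - 1 - 1) t = _); last by rewrite mul_pw ?subrK// ltW.
by field.
Unshelve. all: by end_near. Qed.

Definition supp1 f := forall t, 1 < `|t| -> f t = 0.

Lemma is_derive_logpow s d f f' t : 0 < d -> supp1 f ->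
  (forall t, is_derive (t : R^o) 1 f (f' t)) ->
  is_derive (t : R^o) 1 (logpow s d f)
    (logpow (s - 1) d (fun x => s * f x + d * f' x) t).
Proof.
move=> d0 sf Df; have [t0|t0] := ltP 0 t.
  have D1 : is_derive (t : R^o) 1 (fun t => d * ln t) (d * t^-1).
    by apply: is_derive_fun_scale; exact: is_derive1_ln.
  have D2 := @is_derive_fun_comp R R^o f (fun t => d * ln t) t 1 _ _ (Df (d * ln t)) D1.
  have tn0 : t != 0 by rewrite gt_eqF.
  apply: (is_derive_eq (is_derive_fun_mul (is_derive_pw_neq0 s tn0) D2)).
  rewrite /logpow -[pw s t](_ : t * pw (s - 1) t = _); last by rewrite mul_pw ?subrK// ltW.
  by field.
rewrite logpow_le0//; apply: (is_derive_near (is_derive_fun_cst 0 _ _)).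
near=> x; have [x0|x0] := ltP 0 x; last by rewrite logpow_le0.
rewrite /logpow sf ?mulr0//.
(* Below exp (- 2 / d) the argument of [f] is less than - 2, outside the support; so the function
   vanishes around every [t <= 0]. *)
have : ln x < - (2 / d).
  rewrite -[X in _ < X]expRK ltr_ln ?posrE ?expR_gt0//.
  near: x; apply: lt_nbhsl; exact: le_lt_trans t0 (expR_gt0 _).
move=> lx; have H : d * ln x < d * - (2 / d) by rewrite ltr_pM2l.
rewrite mulrN mulrCA divff ?gt_eqF// mulr1 in H.
rewrite ltr0_norm; lra.
Unshelve. all: by end_near. Qed.

Lemma supp1_derive f f' : supp1 f -> (forall t, is_derive (t : R^o) 1 f (f' t)) -> supp1 f'.
Proof.
move=> sf Df t t1; have [_ <-] := Df t.
have [_ ->] : is_derive (t : R^o) 1 f 0; last by [].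
apply: (is_derive_near (is_derive_fun_cst 0 _ _)).
have : \forall x \near t, 1 < `|x|.
  have cn : {for t, continuous (fun x : R => `|x|)} by exact: norm_continuous.
  have := cn [set y | 1 < y]; apply; exact: lt_nbhsr.
by apply: filterS => x /sf ->.
Qed.

(** The class is closed under differentiation, so derivatives of all orders come from one induction.
    In the last constructor the support condition removes the singularity of ln at 0. *)
Inductive smooth1 : (R -> R) -> Prop :=
| smooth1_cst c : smooth1 (fun=> c)
| smooth1_id : smooth1 (fun t => t)
| smooth1_add f h : smooth1 f -> smooth1 h -> smooth1 (fun t => f t + h t)
| smooth1_mul f h : smooth1 f -> smooth1 h -> smooth1 (fun t => f t * h t)
| smooth1_comp f h : smooth1 f -> smooth1 h -> smooth1 (fun t => f (h t))
| smooth1_gexp s e : 0 < e -> smooth1 (gexp s e)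
| smooth1_logpow s d f : 0 < d -> smooth1 f -> supp1 f -> smooth1 (logpow s d f).

Lemma smooth1_derive f : smooth1 f ->
  exists2 f', smooth1 f' & forall t, is_derive (t : R^o) 1 f (f' t).
Proof.
elim=> {f} [c||f h _ [f' sf' Df] _ [h' sh' Dh]|f h sf [f' sf' Df] sh [h' sh' Dh]
  |f h sf [f' sf' Df] sh [h' sh' Dh]|s e e0|s d f d0 sf [f' sf' Df] ff].
- by exists (fun=> 0); [exact: smooth1_cst|move=> t; exact: is_derive_fun_cst].
- by exists (fun=> 1); [exact: smooth1_cst|move=> t; exact: is_derive_id].
- exists (fun t => f' t + h' t); first exact: smooth1_add.
  by move=> t; apply: is_derive_fun_add.
- exists (fun t => f' t * h t + f t * h' t).
    by apply: smooth1_add; apply: smooth1_mul.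
  by move=> t; apply: is_derive_fun_mul.
- exists (fun t => f' (h t) * h' t).
    by apply: smooth1_mul => //; exact: smooth1_comp.
  by move=> t; apply: is_derive_fun_comp.
- exists (fun t => s * gexp (s - 1) e t + e * gexp (s - 2) e t).
    apply: smooth1_add; apply: smooth1_mul; try exact: smooth1_cst; exact: smooth1_gexp.
  by move=> t; exact: is_derive_gexp.
- exists (logpow (s - 1) d (fun x => s * f x + d * f' x)).
    apply: smooth1_logpow => //.
      by apply: smooth1_add; apply: smooth1_mul => //; exact: smooth1_cst.
    by move=> t t1; rewrite ff// (supp1_derive ff Df)// !mulr0 addr0.
  by move=> t; exact: is_derive_logpow.
Qed.

Lemma smooth1_continuous f : smooth1 f -> continuous f.
Proof. by move=> /smooth1_derive[f' _ Df] t; exact: is_derive1_continuous (Df t). Qed.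

End smooth_generators.

(** * Smooth functions of several variables *)

Section smooth_functions.
Variables (R : realType) (n : nat).
Implicit Types (f : 'rV[R]_n -> R).

Inductive smoothn : ('rV[R]_n -> R) -> Prop :=
| smoothn_cst c : smoothn (fun=> c)
| smoothn_coord i : smoothn (fun z => z 0 i)
| smoothn_add f h : smoothn f -> smoothn h -> smoothn (fun z => f z + h z)
| smoothn_mul f h : smoothn f -> smoothn h -> smoothn (fun z => f z * h z)
| smoothn_comp (F : R -> R) f : smooth1 F -> smoothn f -> smoothn (fun z => F (f z)).

Lemma smoothn_derive f a : smoothn f ->
  exists2 f', smoothn f' & forall z, is_derive z (delta_mx 0 a) f (f' z).
Proof.
elim=> {f} [c|i|f h _ [f' sf' Df] _ [h' sh' Dh]|f h sf [f' sf' Df] sh [h' sh' Dh]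
  |F f sF sf [f' sf' Df]].
- by exists (fun=> 0); [exact: smoothn_cst|move=> t; exact: is_derive_fun_cst].
- by exists (fun=> (i == a)%:R); [exact: smoothn_cst|move=> t; exact: is_derive_coord].
- exists (fun t => f' t + h' t); first exact: smoothn_add.
  by move=> t; apply: is_derive_fun_add.
- exists (fun t => f' t * h t + f t * h' t).
    by apply: smoothn_add; apply: smoothn_mul.
  by move=> t; apply: is_derive_fun_mul.
- have [F' sF' DF] := smooth1_derive sF.
  exists (fun t => F' (f t) * f' t).
    by apply: smoothn_mul => //; exact: smoothn_comp.
  by move=> t; apply: is_derive_fun_comp.
Qed.

Lemma smoothn_differentiable f z : smoothn f -> differentiable f z.
Proof.
elim=> {f} [c|i|f h _ Df _ Dh|f h _ Df _ Dh|F f sF _ Df].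
- exact: differentiable_cst.
- exact: differentiable_coord.
- exact: differentiableD.
- exact: differentiableM.
- have [F' _ DF] := smooth1_derive sF.
  apply: (@differentiable_comp _ _ _ _ f F) => //; apply/derivable1_diffP.
  by case: (DF (f z)).
Qed.

Lemma smoothn_smooth f : smoothn f -> smooth f.
Proof.
move=> sf s z; apply: smoothn_differentiable; elim: s => //= a s IH.
have [f' sf' D] := smoothn_derive a IH.
rewrite (_ : pd a _ = f')//; apply/funext => x; rewrite /pd; exact: derive_val.
Qed.

Lemma smoothn_sum p (f : 'I_p -> 'rV[R]_n -> R) : (forall i, smoothn (f i)) ->
  smoothn (fun z => \sum_(i < p) f i z).
Proof.
elim: p f => [|p IH] f sf.
  rewrite (_ : (fun z => _) = (fun=> 0)); first exact: smoothn_cst.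
  by apply/funext => x; rewrite big_ord0.
rewrite (_ : (fun z => _) = (fun x => f ord0 x + \sum_(i < p) f (lift ord0 i) x)).
  by apply: smoothn_add; [exact: sf|apply: IH => i; exact: sf].
by apply/funext => x; rewrite big_ord_recl.
Qed.

End smooth_functions.

(** * The regularized gauge and its Laplacian *)

Section regularized_gauge.
Variables (R : realType) (m k : nat) (gamma : R).
Notation E := 'rV[R]_(m + k).
Notation g := (1 + gamma).
Notation usq := (@x_sqnorm R m k).
Notation vsq := (@y_sqnorm R m k).
Notation gauge := (@gauge_pow R m k gamma).
Notation xc := (@x_coord R m k).
Notation yc := (@y_coord R m k).
Notation ex i := (delta_mx 0 (lshift k i) : E).
Notation ey j := (delta_mx 0 (rshift m j) : E).
Implicit Types (z : E) (e : R).

Definition reg_gauge e z := gexp g e (usq z) + g ^+ 2 * vsq z.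

(* The derivatives of [t |-> gexp g e t] are powers of [t] times
   quadratic polynomials in [e / t] times [exp (- e / t)]. *)
Definition pexp s (A B C : R) e t : R :=
  pw s t * ((A + B * (e / t) + C * (e / t) ^+ 2) * expR (- (e / t))).

Lemma pexp_gexp s A B C e t :
  pexp s A B C e t = A * gexp s e t + B * (e * gexp (s - 1) e t) +
    C * (e ^+ 2 * gexp (s - 2) e t).
Proof.
rewrite /pexp /gexp; have [t0|t0] := ltP 0 t; last by rewrite !pw_le0//; ring.
rewrite (_ : s - 2 = (s - 1) - 1); last by ring.
rewrite -[pw s t](_ : t * pw (s - 1) t = _); last by rewrite mul_pw ?subrK// ltW.
rewrite -[pw (s - 1) t](_ : t * pw (s - 1 - 1) t = _); last by rewrite mul_pw ?subrK// ltW.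
by field; rewrite gt_eqF.
Qed.

Lemma pexp_param0 s A B C t : pexp s A B C 0 t = pw s t * A.
Proof. by rewrite /pexp mul0r !mulr0 expr0n /= mulr0 !addr0 oppr0 expR0 mulr1. Qed.

Definition dgexp e t := pexp gamma g 1 0 e t.

Lemma is_derive_gexp_dgexp e t : 0 < e -> is_derive (t : R^o) 1 (gexp g e) (dgexp e t).
Proof.
move=> e0; apply: (is_derive_eq (is_derive_gexp _ _ e0)).
rewrite /dgexp pexp_gexp (_ : g - 1 = gamma); last by ring.
by rewrite (_ : gamma - 1 = g - 2); ring.
Qed.

Definition ddgexp e t := gamma * g * gexp (gamma - 1) e t + 2 * gamma * (e * gexp (gamma - 2) e t)
  + e ^+ 2 * gexp (gamma - 3) e t.

Lemma is_derive_dgexp e t : 0 < e -> is_derive (t : R^o) 1 (dgexp e) (ddgexp e t).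
Proof.
move=> e0.
rewrite (_ : dgexp e = fun t => g * gexp gamma e t + e * gexp (gamma - 1) e t); last first.
  by apply/funext => x; rewrite /dgexp pexp_gexp; ring.
apply: (is_derive_eq (is_derive_fun_add
  (is_derive_fun_scale g (is_derive_gexp gamma t e0))
  (is_derive_fun_scale e (is_derive_gexp (gamma - 1) t e0)))).
rewrite /ddgexp (_ : gamma - 1 - 1 = gamma - 2); last by ring.
rewrite (_ : gamma - 1 - 2 = gamma - 3); last by ring.
ring.
Qed.

(** In the Laplacian of a function of |x|^2 the second derivative carries a factor |x|^2; with it
    the power is again [gamma], the one to be extracted uniformly in [e]. *)
Lemma mul_ddgexp e t : 0 <= t -> t * ddgexp e t = pexp gamma (gamma * g) (2 * gamma) 1 e t.
Proof.
move=> t0; rewrite pexp_gexp /ddgexp /gexp.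
rewrite -[pw gamma t](_ : t * pw (gamma - 1) t = _); last by rewrite mul_pw ?subrK.
rewrite -[pw (gamma - 1) t](_ : t * pw (gamma - 2) t = _); last first.
  by rewrite mul_pw//; congr (pw _ _); ring.
rewrite -[pw (gamma - 2) t](_ : t * pw (gamma - 3) t = _); last first.
  by rewrite mul_pw//; congr (pw _ _); ring.
ring.
Qed.

Lemma rgauge_param0 z : reg_gauge 0 z = gauge z.
Proof. by rewrite /reg_gauge /gexp mul0r oppr0 expR0 mulr1. Qed.

Lemma is_derive_usq_comp_x (F F' : R -> R) i z :
  (forall t, is_derive (t : R^o) 1 F (F' t)) ->
  is_derive z (ex i) (fun z => F (usq z)) (F' (usq z) * (2 * xc i z)).
Proof. by move=> DF; exact: (is_derive_fun_comp (DF _) (is_derive_usq i z)). Qed.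

Lemma is_derive_rgauge_x e i z : 0 < e ->
  is_derive z (ex i) (reg_gauge e) (dgexp e (usq z) * (2 * xc i z)).
Proof.
move=> e0; rewrite -[X in is_derive _ _ _ X]addr0; apply: is_derive_fun_add.
  by apply: is_derive_usq_comp_x => t; exact: is_derive_gexp_dgexp.
by apply: is_derive_along_cst => h; rewrite vsq_shift_x.
Qed.

Lemma is_derive_rgauge_y e j z : is_derive z (ey j) (reg_gauge e) (2 * g ^+ 2 * yc j z).
Proof.
apply: (is_derive_eq (is_derive_fun_add (is_derive_fx_y (gexp g e) j z)
  (is_derive_fun_scale (g ^+ 2) (is_derive_vsq j z)))).
ring.
Qed.

Lemma smoothn_rgauge e : 0 < e -> smoothn (reg_gauge e).
Proof.
move=> e0; apply: smoothn_add.
  apply: (smoothn_comp (smooth1_gexp g e0)); apply: smoothn_sum => i.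
  by apply: smoothn_mul; exact: smoothn_coord.
apply: smoothn_mul; first exact: smoothn_cst.
by apply: smoothn_sum => i; apply: smoothn_mul; exact: smoothn_coord.
Qed.

Section composed.
Variables (F F1 F2 : R -> R) (e : R).
Hypothesis e0 : 0 < e.
Hypothesis DF : forall t, is_derive (t : R^o) 1 F (F1 t).
Hypothesis DF1 : forall t, is_derive (t : R^o) 1 F1 (F2 t).
Notation phi := (fun z => F (reg_gauge e z)).

Lemma pd_comp_x i : pd (lshift k i) phi = fun z => F1 (reg_gauge e z) * (dgexp e (usq z) * (2 * xc i z)).
Proof.
apply/funext => z; apply: derive_val; exact: (is_derive_fun_comp (DF _) (is_derive_rgauge_x i z e0)).
Qed.

Lemma pd_comp_y j : pd (rshift m j) phi = fun z => F1 (reg_gauge e z) * (2 * g ^+ 2 * yc j z).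
Proof.
apply/funext => z; apply: derive_val; exact: (is_derive_fun_comp (DF _) (is_derive_rgauge_y e j z)).
Qed.

Lemma pd2_comp_x i z : pd (lshift k i) (pd (lshift k i) phi) z =
  F2 (reg_gauge e z) * (dgexp e (usq z) * (2 * xc i z)) ^+ 2 +
  F1 (reg_gauge e z) * (ddgexp e (usq z) * (2 * xc i z) ^+ 2 + 2 * dgexp e (usq z)).
Proof.
rewrite pd_comp_x; apply: derive_val.
apply: (is_derive_eq (is_derive_fun_mul
  (is_derive_fun_comp (DF1 _) (is_derive_rgauge_x i z e0))
  (is_derive_fun_mul (is_derive_usq_comp_x i z (fun t => is_derive_dgexp t e0))
    (is_derive_fun_scale 2 (is_derive_xc_x i i z))))).
by rewrite eqxx /=; ring.
Qed.

Lemma pd2_comp_y j z : pd (rshift m j) (pd (rshift m j) phi) z =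
  F2 (reg_gauge e z) * (2 * g ^+ 2 * yc j z) ^+ 2 + F1 (reg_gauge e z) * (2 * g ^+ 2).
Proof.
rewrite pd_comp_y; apply: derive_val.
apply: (is_derive_eq (is_derive_fun_mul
  (is_derive_fun_comp (DF1 _) (is_derive_rgauge_y e j z))
  (is_derive_fun_scale (2 * g ^+ 2) (is_derive_yc_y j j z)))).
by rewrite eqxx /=; ring.
Qed.

Lemma gradsq_comp z : gradsq gamma (fun a => pd a phi) z =
  F1 (reg_gauge e z) ^+ 2 *
  (4 * usq z * dgexp e (usq z) ^+ 2 + 4 * g ^+ 4 * (pw gamma (usq z) * vsq z)).
Proof.
set p1 := F1 (reg_gauge e z); set p := dgexp e (usq z).
rewrite /gradsq (eq_bigr (fun i => 4 * (p1 * p) ^+ 2 * xc i z ^+ 2)); last first.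
  by move=> i _; rewrite pd_comp_x -/p1 -/p; ring.
rewrite [X in _ + _ * X = _](eq_bigr (fun j => 4 * g ^+ 4 * p1 ^+ 2 * yc j z ^+ 2)); last first.
  by move=> j _; rewrite pd_comp_y -/p1; ring.
by rewrite -!mulr_sumr -/(usq z) -/(vsq z); ring.
Qed.

(** The Laplacian divided by |x|^gamma. Only half of its factor |x|^(2 gamma) is taken out, so that
    the square is the Laplacian squared over |x|^(2 gamma), while the powers of |x| left over are
    positive and keep it continuous on x = 0. *)
Definition half_lapl (F1 F2 : R -> R) e z :=
  F2 (reg_gauge e z) * (4 * usq z * (pexp (gamma / 2) g 1 0 e (usq z) * pexp gamma g 1 0 e (usq z))
    + 4 * g ^+ 4 * (vsq z * pw (gamma / 2) (usq z))) +
  F1 (reg_gauge e z) * (4 * pexp (gamma / 2) (gamma * g) (2 * gamma) 1 e (usq z)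
    + 2 * m%:R * pexp (gamma / 2) g 1 0 e (usq z)
    + 2 * g ^+ 2 * k%:R * pw (gamma / 2) (usq z)).

Lemma pexp_half A B C t : pexp gamma A B C e t = pw (gamma / 2) t * pexp (gamma / 2) A B C e t.
Proof. by rewrite /pexp [in LHS](splitr gamma) pwD; ring. Qed.

Lemma lapl_comp z : lapl gamma (fun a => pd a (pd a phi)) z =
  pw (gamma / 2) (usq z) * half_lapl F1 F2 e z.
Proof.
set p1 := F1 (reg_gauge e z); set p2 := F2 (reg_gauge e z).
set p := dgexp e (usq z); set r := ddgexp e (usq z).
have Er := @mul_ddgexp e (usq z) (usq_ge0 z); rewrite -/r pexp_half in Er.
have Ep : p = pw (gamma / 2) (usq z) * pexp (gamma / 2) g 1 0 e (usq z).
  by rewrite /p /dgexp pexp_half.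
rewrite /lapl (eq_bigr (fun i => 2 * p1 * p + (4 * p2 * p ^+ 2 + 4 * p1 * r) * xc i z ^+ 2)); last first.
  by move=> i _; rewrite pd2_comp_x -/p1 -/p2 -/p -/r; ring.
rewrite [X in _ + _ * X = _](eq_bigr (fun j => 2 * g ^+ 2 * p1 + 4 * g ^+ 4 * p2 * yc j z ^+ 2)); last first.
  by move=> j _; rewrite pd2_comp_y -/p1 -/p2; ring.
clearbody p r; rewrite !big_split /= -!mulr_sumr !sumr_const !card_ord -/(usq z) -/(vsq z).
rewrite -[_ *+ m]mulr_natl -[_ *+ k]mulr_natl.
rewrite /half_lapl -/p1 -/p2 [pexp gamma g 1 0 e _]pexp_half.
rewrite [in pw gamma (usq z)](splitr gamma) pwD.
move: Er; set X := pexp _ (gamma * g) _ _ _ _ => Er; rewrite Ep.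
set q := pw (gamma / 2) (usq z) in Er *; set Y := pexp _ _ _ _ _ _.
(* [Er] concerns only the product of [r] with [usq z], so the term in [X] is isolated before it is
   replaced. *)
have -> : q * (p2 * (4 * usq z * (Y * (q * Y)) + 4 * g ^+ 4 * (vsq z * q)) +
   p1 * (4 * X + 2 * m%:R * Y + 2 * g ^+ 2 * k%:R * q)) =
   q * (p2 * (4 * usq z * (Y * (q * Y)) + 4 * g ^+ 4 * (vsq z * q)) +
   p1 * (2 * m%:R * Y + 2 * g ^+ 2 * k%:R * q)) + 4 * p1 * (q * X) by ring.
rewrite -Er; ring.
Qed.

(** On x = 0 both sides are 0, the left one as a division by zero. *)
Lemma lapl_comp_sqr z : lapl gamma (fun a => pd a (pd a phi)) z ^+ 2 / pw gamma (usq z) =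
  half_lapl F1 F2 e z ^+ 2.
Proof.
rewrite lapl_comp; have [u0|u0] := ltP 0 (usq z); last first.
  rewrite !pw_le0// mul0r expr0n mul0r /half_lapl /pexp !pw_le0//.
  by rewrite !mul0r !mulr0 !addr0 !mulr0 addr0 expr0n.
rewrite [in pw gamma _](splitr gamma) pwD; field.
by rewrite gt_eqF// pw_gt0.
Qed.

End composed.
End regularized_gauge.

(** * Passage to the limit in the regularization *)

Section regularization_limit.
Variables (R : realType) (m k : nat) (gamma : R).
Hypothesis gamma0 : 0 < gamma.
Notation E := 'rV[R]_(m + k).
Notation g := (1 + gamma).
Notation usq := (@x_sqnorm R m k).
Notation vsq := (@y_sqnorm R m k).
Notation gauge := (@gauge_pow R m k gamma).
Notation rgauge := (@reg_gauge R m k gamma).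
Implicit Types (z : E) (e : R) (p : R * E).

Lemma joint_snd (f : E -> R) p : cont_at f p.2 -> cont_at (fun p => f p.2) p.
Proof.
by case: p => d z cf; apply: (@cvg_comp _ _ _ snd f _ (nbhs z)) => //; exact: cvg_snd.
Qed.

Lemma joint_slice (f : R -> E -> R) (d : R) z :
  cont_at (fun p => f p.1 p.2) (d, z) -> cont_at (f d) z.
Proof.
move=> cf; apply: (@cvg_comp _ _ _ (fun z => (d, z)) (fun p => f p.1 p.2) _ (nbhs (d, z))) => //.
move=> P [[U V] /= [Ud Vz] UV]; rewrite /nbhs /=; apply: filterS Vz => z' Vz'.
by apply: (UV (d, z')); split => //; exact: nbhs_singleton.
Qed.

(** The constants 1 and 2 come from 1 + x <= exp x and 1 + x^2 / 2 <= exp x. *)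
Lemma pexp_factor_bound (A B C x : R) : 0 <= x ->
  `|(A + B * x + C * x ^+ 2) * expR (- x)| <= `|A| + `|B| + `|C| * 2.
Proof.
move=> x0; have e0 := expR_gt0 (- x).
have E1 : expR (- x) <= 1 by rewrite -expR0 ler_expR oppr_le0.
have Ex : expR x * expR (- x) = 1 by rewrite expRN divff// gt_eqF// expR_gt0.
have E2 : x * expR (- x) <= 1.
  by rewrite -Ex ler_wpM2r ?(ltW e0)//; have := expR_ge1Dx x; lra.
have E3 : x ^+ 2 * expR (- x) <= 2.
  apply: (@le_trans _ _ (2 * expR x * expR (- x))); last by rewrite -mulrA Ex mulr1.
  rewrite ler_wpM2r ?(ltW e0)//.
  have H : 1 + x ^+ 2 / 2 <= expR x by exact: (@expR_ge1Dxn R x 1 x0).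
  lra.
rewrite normrM (ger0_norm (ltW e0)).
apply: (@le_trans _ _ ((`|A| + `|B| * x + `|C| * x ^+ 2) * expR (- x))).
  rewrite ler_wpM2r ?(ltW e0)//; apply: le_trans (ler_normD _ _) _.
  have -> : `|C * x ^+ 2| = `|C| * x ^+ 2.
    by rewrite normrM; congr (_ * _); exact: ger0_norm (sqr_ge0 x).
  rewrite lerD2r.
  by apply: le_trans (ler_normD _ _) _; rewrite normrM (ger0_norm x0).
rewrite !mulrDl -!mulrA; apply: lerD; first apply: lerD.
- by rewrite ler_piMr.
- by rewrite ler_piMr.
- by rewrite ler_wpM2l// mulrA -expr2.
Qed.

(** At x = 0 and e = 0 the quotient e / |x|^2 has no limit; joint continuity comes from the uniform
    bound on the other factor and from |x|^(2 s) -> 0. Writing e as a square lets the parameter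
    range over a full neighbourhood of 0 with [e >= 0]. *)
Lemma joint_pexp s (A B C : R) p : 0 < s ->
  cont_at (fun p => pexp s A B C (p.1 ^+ 2) (usq p.2)) p.
Proof.
move=> s0.
have cu : cont_at (fun p => usq p.2) p by apply: joint_snd; exact: cont_usq.
have cpu : cont_at (fun p => pw s (usq p.2)) p.
  by apply: (@joint_snd (fun z => pw s (usq z))); exact: cont_pw_usq.
have [u0|u0] := eqVneq (usq p.2) 0.
  pose D := `|A| + `|B| + `|C| * 2.
  rewrite /cont_at /prop_for /continuous_at /pexp u0 pw_le0// mul0r.
  apply: (@squeeze_cvgr _ _ _ _ (fun p => - (D * pw s (usq p.2))) (fun p => D * pw s (usq p.2))).
  - near=> q; rewrite -ler_norml normrM (ger0_norm (pw_ge0 _ _)) mulrC.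
    rewrite ler_wpM2r ?pw_ge0//; apply: pexp_factor_bound.
    by rewrite divr_ge0 ?sqr_ge0 ?usq_ge0.
  - rewrite -[X in _ --> X]oppr0 -[X in _ --> - X](mulr0 D); apply: cvgN; apply: cvgM; first exact: cvg_cst.
    by move: cpu; rewrite /cont_at /prop_for /continuous_at u0 pw_le0.
  - rewrite -[X in _ --> X](mulr0 D); apply: cvgM; first exact: cvg_cst.
    by move: cpu; rewrite /cont_at /prop_for /continuous_at u0 pw_le0.
have cd : cont_at (fun p => p.1) p by exact: cvg_fst.
have ci : cont_at (fun p => (usq p.2)^-1) p by apply: cvgV.
have cx : cont_at (fun p => p.1 ^+ 2 / usq p.2) p by cts.
have ce : cont_at (fun p => expR (- (p.1 ^+ 2 / usq p.2))) p.
  apply: (@cont_comp _ _ _ expR); first exact: continuous_expR.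
  by apply: cvgN.
rewrite /pexp; apply: cont_mul => //; apply: cont_mul => //.
by apply: cont_add; [apply: cont_add; [exact: cont_cst|apply: cont_mul => //; exact: cont_cst]
  |apply: cont_mul; [exact: cont_cst|exact: cont_sqr]].
Unshelve. all: by end_near. Qed.

Lemma joint_rgauge p : cont_at (fun p => rgauge (p.1 ^+ 2) p.2) p.
Proof.
have -> : (fun p => rgauge (p.1 ^+ 2) p.2) =
    (fun p => pexp g 1 0 0 (p.1 ^+ 2) (usq p.2) + g ^+ 2 * vsq p.2).
  by apply/funext => q; rewrite /reg_gauge pexp_gexp; ring.
apply: cont_add; first by apply: joint_pexp; exact: g_gt0.
apply: cont_mul; first exact: cont_cst.
by apply: joint_snd; exact: cont_vsq.
Qed.

(** This gives one box for all [e] in [0, 1]: when some |x_i| exceeds [M >= 1], exp (- e / |x|^2) is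
    at least exp (- 1), whence the factor [expR 1]. *)
Lemma rgauge_gt (B M : R) e z : 0 < B -> 1 <= M -> expR 1 * B <= M -> 0 <= e <= 1 ->
  ~ box M z -> B < rgauge e z.
Proof.
move=> B0 M1 BM /andP[e0 e1] /existsNP [a /negP]; rewrite -ltNge => za.
have M0 : 0 < M by lra.
have za2 : M < z 0 a ^+ 2.
  rewrite -real_normK ?num_real//; apply: (lt_le_trans za).
  by rewrite expr2 ler_peMl//; apply: ltW; exact: le_lt_trans M1 za.
have g1 := g_gt1 gamma0.
have v0 := vsq_ge0 z.
have E1 : 1 < expR 1 :> R by have := expR_ge1Dx (1 : R); lra.
case: (split_ordP a) za2 => [i|j] ->.
  move=> xM; have uM : M < usq z.
    apply: lt_le_trans xM _; rewrite /x_sqnorm (bigD1 i)//= lerDl.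
    by apply: sumr_ge0 => l _; exact: sqr_ge0.
  have u1 : 1 <= usq z by lra.
  have u0 : 0 < usq z by lra.
  apply: (@lt_le_trans _ _ (gexp g e (usq z))); last first.
    by rewrite /reg_gauge lerDl mulr_ge0// sqr_ge0.
  apply: (@lt_le_trans _ _ (usq z * expR (- 1))).
    by rewrite expRN ltr_pdivlMr ?expR_gt0// mulrC (le_lt_trans BM).
  apply: ler_pM; rewrite ?expR_ge0 ?(ltW u0)//.
    by rewrite pwE// le1r_powR// ltW.
  by rewrite ler_expR lerN2 ler_pdivrMr// mul1r (le_trans e1).
move=> yM; have vM : M < vsq z.
  apply: lt_le_trans yM _; rewrite /y_sqnorm (bigD1 j)//= lerDl.
  by apply: sumr_ge0 => l _; exact: sqr_ge0.
apply: (@lt_le_trans _ _ (vsq z)).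
  apply: le_lt_trans vM; apply: le_trans BM.
  by rewrite ler_peMl ?ltW.
apply: (@le_trans _ _ (g ^+ 2 * vsq z)); last by rewrite lerDr gexp_ge0.
by rewrite ler_peMl// exprn_ege1// ltW.
Qed.

Section family.
Variables (alpha : R) (F F1 F2 : R -> R) (A B : R).
Hypothesis alpha2 : 2 < alpha.
Hypothesis sF : smooth1 F.
Hypothesis sF1 : smooth1 F1.
Hypothesis sF2 : smooth1 F2.
Hypothesis DF : forall t, is_derive (t : R^o) 1 F (F1 t).
Hypothesis DF1 : forall t, is_derive (t : R^o) 1 F1 (F2 t).
Hypothesis A0 : 0 < A.
Hypothesis B0 : 0 < B.
Hypothesis FA : forall t, t < A -> F t = 0.
Hypothesis FB : forall t, B < t -> [/\ F t = 0, F1 t = 0 & F2 t = 0].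
Notation be := ((alpha - 2) / (2 * g)).
Notation M := (Num.max 1 (expR 1 * B)).
Notation phi e := (fun z => F (rgauge e z)).

(** At [e = 0] this is a limit integrand only: [F] composed with the gauge itself need not be
    admissible. *)
Definition lhs_family (e : R) z := pw (be + 1) (gauge z) * half_lapl gamma F1 F2 e z ^+ 2.

Definition den_family (e : R) z := pw be (gauge z) * (F1 (rgauge e z) ^+ 2 *
  (4 * usq z * dgexp gamma e (usq z) ^+ 2 + 4 * g ^+ 4 * (pw gamma (usq z) * vsq z))).

Let be0 : 0 < be.
Proof. by rewrite divr_gt0 ?subr_gt0// mulr_gt0// g_gt0. Qed.

Lemma cont_pw_gauge_pos s z : 0 < s -> cont_at (fun z => pw s (gauge z)) z.
Proof.
move=> s0; apply: (@cont_comp _ _ _ (pw s)); last exact: cont_gauge.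
exact: pw_continuous.
Qed.

Lemma joint_comp_rgauge (G : R -> R) p : smooth1 G ->
  cont_at (fun p => G (rgauge (p.1 ^+ 2) p.2)) p.
Proof.
move=> sG; apply: (@cont_comp _ _ _ G); last exact: joint_rgauge.
exact: smooth1_continuous.
Qed.

Lemma joint_lhs_family p : cont_at (fun p => lhs_family (p.1 ^+ 2) p.2) p.
Proof.
have g2 : 0 < gamma / 2 by rewrite divr_gt0.
have c1 := @joint_comp_rgauge F1 p sF1.
have c2 := @joint_comp_rgauge F2 p sF2.
have c3 : cont_at (fun p => usq p.2) p by apply: joint_snd; exact: cont_usq.
have c4 : cont_at (fun p => vsq p.2) p by apply: joint_snd; exact: cont_vsq.
have c5 : cont_at (fun p => pw (gamma / 2) (usq p.2)) p.
  by apply: (@joint_snd (fun z => pw (gamma / 2) (usq z))); exact: cont_pw_usq.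
have c6 : cont_at (fun p => pw (be + 1) (gauge p.2)) p.
  by apply: (@joint_snd (fun z => pw (be + 1) (gauge z))); apply: cont_pw_gauge_pos; rewrite addr_gt0.
have c7 := @joint_pexp (gamma / 2) g 1 0 p g2.
have c8 := @joint_pexp gamma g 1 0 p gamma0.
have c9 := @joint_pexp (gamma / 2) (gamma * g) (2 * gamma) 1 p g2.
by rewrite /lhs_family /half_lapl; cts.
Qed.

Lemma joint_den_family p : cont_at (fun p => den_family (p.1 ^+ 2) p.2) p.
Proof.
have c1 := @joint_comp_rgauge F1 p sF1.
have c3 : cont_at (fun p => usq p.2) p by apply: joint_snd; exact: cont_usq.
have c4 : cont_at (fun p => vsq p.2) p by apply: joint_snd; exact: cont_vsq.
have c5 : cont_at (fun p => pw gamma (usq p.2)) p.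
  by apply: (@joint_snd (fun z => pw gamma (usq z))); exact: cont_pw_usq.
have c6 : cont_at (fun p => pw be (gauge p.2)) p.
  by apply: (@joint_snd (fun z => pw be (gauge z))); apply: cont_pw_gauge_pos.
have c8 : cont_at (fun p => dgexp gamma (p.1 ^+ 2) (usq p.2)) p by exact: joint_pexp.
by rewrite /den_family; cts.
Qed.

Lemma rgauge_gtB (d : R) z : `|d| <= 1 -> ~ box M z -> B < rgauge (d ^+ 2) z.
Proof.
move=> d1; apply: rgauge_gt; rewrite ?le_max ?lexx ?orbT//.
by rewrite sqr_ge0 -real_normK ?num_real// expr_le1.
Qed.

Lemma CC_lhs_family (d : R) : `|d| <= 1 -> CC M (lhs_family (d ^+ 2)).
Proof.
move=> d1; split=> [z|z zM].
  exact: (@joint_slice (fun d => lhs_family (d ^+ 2)) d z (@joint_lhs_family _)).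
have [_ e1 e2] := FB (rgauge_gtB d1 zM).
by rewrite /lhs_family /half_lapl e1 e2 !mul0r addr0 expr0n mulr0.
Qed.

Lemma CC_den_family (d : R) : `|d| <= 1 -> CC M (den_family (d ^+ 2)).
Proof.
move=> d1; split=> [z|z zM].
  exact: (@joint_slice (fun d => den_family (d ^+ 2)) d z (@joint_den_family _)).
have [_ e1 e2] := FB (rgauge_gtB d1 zM).
by rewrite /den_family e1 expr0n !mul0r mulr0.
Qed.

Lemma near_norm_le1 : \forall d \near (0 : R), `|d| <= 1.
Proof.
apply/nbhs_ballP; exists 1 => //= d; rewrite /ball /= sub0r normrN.
exact: ltW.
Qed.

Lemma cvg_lhs_family : ri (lhs_family (d ^+ 2)) @[d --> (0 : R)] --> ri (lhs_family 0).
Proof.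
have := @ri_param_cvg R _ _ (0 : R) M (fun d => lhs_family (d ^+ 2)) _ _.
rewrite expr0n; apply.
  by apply: filterS near_norm_le1 => d; exact: CC_lhs_family.
by move=> z; exact: joint_lhs_family.
Qed.

Lemma cvg_den_family : ri (den_family (d ^+ 2)) @[d --> (0 : R)] --> ri (den_family 0).
Proof.
have := @ri_param_cvg R _ _ (0 : R) M (fun d => den_family (d ^+ 2)) _ _.
rewrite expr0n; apply.
  by apply: filterS near_norm_le1 => d; exact: CC_den_family.
by move=> z; exact: joint_den_family.
Qed.

Lemma gauge0 : gauge 0 = 0.
Proof.
rewrite /gauge_pow /y_sqnorm /x_sqnorm.
by rewrite !big1 ?mulr0 ?pw_le0 ?addr0// => i _; rewrite /x_coord /y_coord mxE expr0n.
Qed.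

Lemma rgauge_at0 e : rgauge e 0 = 0.
Proof.
rewrite /reg_gauge /y_sqnorm /x_sqnorm.
by rewrite !big1 ?mulr0 ?gexp_le0 ?addr0// => i _; rewrite /x_coord /y_coord mxE expr0n.
Qed.

Lemma admissible_family (d : R) : d != 0 -> `|d| <= 1 -> admissible (phi (d ^+ 2)).
Proof.
move=> d0 d1; have e0 : 0 < d ^+ 2 by rewrite exprn_even_gt0.
have sg := smoothn_rgauge m k gamma e0.
split; first by apply: smoothn_smooth; exact: smoothn_comp.
(* The regularized gauge is 0 at the origin, so the lower bound [A] keeps the support away from
   it. *)
exists (box M `&` [set z | A <= rgauge (d ^+ 2) z]); split; last split.
- apply: compact_closedI; first exact: box_compact.
  apply: (@closed_comp _ _ (rgauge (d ^+ 2)) [set x | A <= x]); last exact: closed_ge.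
  by move=> z _; apply: differentiable_continuous; exact: smoothn_differentiable.
- by move=> [_ /=]; rewrite rgauge_at0 leNgt A0.
- move=> z /not_andP[zM|/negP]; last by rewrite -ltNge => /FA.
  by have [] := FB (rgauge_gtB d1 zM).
Qed.

Lemma lhs_int_family (d : R) : d != 0 -> `|d| <= 1 ->
  lhs_int gamma alpha (phi (d ^+ 2)) = (ri (lhs_family (d ^+ 2)))%:E.
Proof.
move=> d0 d1; have e0 : 0 < d ^+ 2 by rewrite exprn_even_gt0.
rewrite -(iint_ri (CC_lhs_family d1)) /lhs_int; congr iint; apply/funext => z.
congr EFin; rewrite -/(lhs_integrand gamma alpha (phi (d ^+ 2)) z).
have [->|z0] := eqVneq z 0.
  by rewrite lhs_integrand_at0// /lhs_family gauge0 pw_le0// mul0r.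
by rewrite lhs_integrandE// -mulrA (lapl_comp_sqr gamma e0 DF DF1).
Qed.

Lemma den_int_family (d : R) : d != 0 -> `|d| <= 1 ->
  den_int gamma alpha (phi (d ^+ 2)) = (ri (den_family (d ^+ 2)))%:E.
Proof.
move=> d0 d1; have e0 : 0 < d ^+ 2 by rewrite exprn_even_gt0.
rewrite -(iint_ri (CC_den_family d1)) /den_int; congr iint; apply/funext => z.
by congr EFin; rewrite den_integrandE// (gradsq_comp gamma e0 DF).
Qed.

End family.
End regularization_limit.

(** * Profiles in the logarithm of the gauge *)

Section profiles.
Variable R : realType.
Notation leb := (@lebesgue_measure R).
Implicit Types (f h : R -> R) (d s t : R).

Definition profile f := continuous f /\ supp1 f.

Lemma profile_add f h : profile f -> profile h -> profile (fun t => f t + h t).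
Proof.
move=> [cf sf] [ch sh]; split=> [t|t t1]; first by apply: cont_add; [exact: cf|exact: ch].
by rewrite sf// sh// addr0.
Qed.

Lemma profile_scale c f : profile f -> profile (fun t => c * f t).
Proof.
move=> [cf sf]; split=> [t|t t1]; first by apply: cont_mul; [exact: cont_cst|exact: cf].
by rewrite sf// mulr0.
Qed.

Lemma profile_mul f h : profile f -> profile h -> profile (fun t => f t * h t).
Proof.
move=> [cf sf] [ch sh]; split=> [t|t t1]; first by apply: cont_mul; [exact: cf|exact: ch].
by rewrite sf// mul0r.
Qed.

Lemma profile_sqr f : profile f -> profile (fun t => f t ^+ 2).
Proof. by move=> pf; exact: profile_mul. Qed.

Lemma logpow_out s d f t : 0 < d -> supp1 f ->
  t < expR (- d^-1) \/ expR d^-1 < t -> logpow s d f t = 0.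
Proof.
move=> d0 sf H; have [t0|t0] := ltP 0 t; last by rewrite logpow_le0.
rewrite /logpow sf ?mulr0// ltNge ler_norml; apply/negP => /andP[h1 h2].
case: H => H; have : expR (ln t) = t by rewrite lnK.
  have : - d^-1 <= ln t by rewrite -(ler_pM2l d0) mulrN divff// gt_eqF.
  by rewrite -ler_expR => h3 h4; move: H; rewrite ltNge -h4 h3.
have : ln t <= d^-1 by rewrite -(ler_pM2l d0) divff// gt_eqF.
by rewrite -ler_expR => h3 h4; move: H; rewrite ltNge -h4 h3.
Qed.

Lemma logpow_continuous s d f : 0 < d -> profile f -> continuous (logpow s d f).
Proof.
move=> d0 [cf sf] t; have [t0|t0] := ltP 0 t.
  apply: cont_mul; first by apply: pw_cont_neq0; rewrite gt_eqF.
  apply: (@cont_comp _ _ _ f); first exact: cf.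
  by apply: cont_mul; [exact: cont_cst|exact: continuous_ln].
apply: (@cont_near _ _ (fun=> 0)); first exact: cont_cst.
have : \forall x \near t, x < expR (- d^-1).
  by apply: lt_nbhsl; exact: le_lt_trans t0 (expR_gt0 _).
by apply: filterS => x xd; rewrite logpow_out//; left.
Qed.

Lemma mul_logpow s d f t : 0 <= t -> t * logpow (s - 1) d f t = logpow s d f t.
Proof. by move=> t0; rewrite /logpow mulrA mul_pw// subrK. Qed.

(** The zero mean brings the primitive back to 0 on the right of the support. *)
Lemma profile_primitive f : profile f -> \int[leb]_t f t = 0 ->
  exists2 F, profile F & forall t, is_derive (t : R^o) 1 F (f t).
Proof.
move=> [cf sf] f0.
have CF : CCfun1 1 f by [].
have If := CC1_integrable CF.
pose F x := \int[leb]_(t in `]-oo, x]) f t.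
have DF t : is_derive (t : R^o) 1 F (f t).
  have tt : t < t + 1 by rewrite ltrDl.
  have I : leb.-integrable [set` Interval -oo%O (BRight (t + 1))] (EFin \o f).
    by apply: integrableS If.
  case: (@continuous_FTC1 R f -oo%O t (t + 1) tt I _ (cf t)); first by rewrite ltNyr.
  move=> D E; by apply: DeriveDef; [exact: D|rewrite -derive1E; exact: E].
exists F => //; split=> [t|t]; first exact: is_derive1_continuous (DF t).
have z0 (D : set R) : (forall x, D x -> f x = 0) -> \int[leb]_(t in D) f t = 0.
  by move=> H; rewrite /Rintegral integral0_eq// => x /H ->.
rewrite ltr_normr => /orP[t1|t1]; last first.
  apply: z0 => // x; rewrite /= in_itv /= => xt; apply: sf.
  by rewrite ltr_normr; apply/orP; right; lra.
have := f0; rewrite -(setUv `]-oo, t]) Rintegral_setU //.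
- rewrite [X in _ + X]z0 ?addr0// => x /=; rewrite in_itv /= => /negP; rewrite -ltNge => tx.
  by apply: sf; rewrite ltr_normr; apply/orP; left; lra.
- by apply: measurableC; exact: measurable_itv.
- by rewrite setUv.
- by apply/disj_setPS; rewrite setICr.
Qed.

End profiles.

(** * The integral of a profile over the space *)

Section radial_functional.
Variables (R : realType) (m k : nat) (gamma : R).
Hypothesis gamma0 : 0 < gamma.
Notation E := 'rV[R]_(m + k).
Notation g := (1 + gamma).
Notation usq := (@x_sqnorm R m k).
Notation vsq := (@y_sqnorm R m k).
Notation gauge := (@gauge_pow R m k gamma).
Notation xc := (@x_coord R m k).
Notation yc := (@y_coord R m k).
Notation Q := (Qdim m k gamma).
Implicit Types (z : E) (f h : R -> R) (d : R).

(* The exponent for which [radial] only sees the integral of the profile in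
   the variable [ln gauge]. *)
Definition cexp : R := - (Q + 2 * gamma) / (2 * g).

Definition radial_integrand d f z := pw gamma (usq z) * logpow cexp d f (gauge z).

(** The weight has homogeneity - Q, so polar coordinates would give a constant times 1 / d times the
    integral of [f]; [radial_derive] stands in for that formula. *)
Definition radial d f := ri (radial_integrand d f).

Notation M d := (Num.max 1 (expR 1 * expR d^-1)).

Lemma gauge_gt_box d z : ~ box (M d) z -> expR d^-1 < gauge z.
Proof.
move=> zM; rewrite -rgauge_param0; apply: (rgauge_gt gamma0 _ _ _ _ zM).
- exact: expR_gt0.
- by rewrite le_max lexx.
- by rewrite le_max lexx orbT.
- by rewrite lexx ler01.
Qed.

Lemma CC_radial d f : 0 < d -> profile f -> CC (M d) (radial_integrand d f).
Proof.
move=> d0 pf; split=> [z|z zM].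
  apply: (@cont_mul _ _ (fun z => pw gamma (usq z)) (fun z => logpow cexp d f (gauge z))).
    exact: cont_pw_usq.
  apply: (@cont_comp _ _ _ (logpow cexp d f)); last exact: cont_gauge.
  exact: logpow_continuous.
by rewrite /radial_integrand logpow_out ?mulr0//; [exact: pf.2|right; exact: gauge_gt_box].
Qed.

Lemma radial_add d f h : 0 < d -> profile f -> profile h ->
  radial d (fun t => f t + h t) = radial d f + radial d h.
Proof.
move=> d0 pf ph; rewrite /radial -(riD (CC_radial d0 pf) (CC_radial d0 ph)).
by congr ri; apply/funext => z; rewrite /radial_integrand /logpow; ring.
Qed.

Lemma radial_scale d c f : 0 < d -> profile f ->
  radial d (fun t => c * f t) = c * radial d f.
Proof.
move=> d0 pf; rewrite /radial -(riZ c (CC_radial d0 pf)).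
by congr ri; apply/funext => z; rewrite /radial_integrand /logpow; ring.
Qed.

Lemma radial_le d f h : 0 < d -> profile f -> profile h -> (forall t, f t <= h t) ->
  radial d f <= radial d h.
Proof.
move=> d0 pf ph fh; apply: (ri_le (CC_radial d0 pf) (CC_radial d0 ph)) => z.
by rewrite /radial_integrand /logpow !ler_wpM2l ?pw_ge0.
Qed.

Lemma radial_ge0 d f : 0 < d -> profile f -> (forall t, 0 <= f t) -> 0 <= radial d f.
Proof.
move=> d0 pf f0; apply: (ri_ge0 (CC_radial d0 pf)) => z.
by rewrite /radial_integrand /logpow !mulr_ge0 ?pw_ge0.
Qed.

Lemma radial_gt0 d f : (0 < m)%N -> 0 < d -> profile f -> (forall t, 0 <= f t) ->
  0 < f 0 -> 0 < radial d f.
Proof.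
move=> m0 d0 pf f0 fp.
pose z0 : E := delta_mx 0 (lshift k (Ordinal m0)).
have u1 : usq z0 = 1.
  rewrite /x_sqnorm (bigD1 (Ordinal m0))//= big1 ?addr0.
    by rewrite /x_coord mxE !eqxx /= expr1n.
  move=> i /negbTE i0; rewrite /x_coord mxE eqxx (inj_eq (@lshift_inj _ _)) i0 /=.
  by rewrite expr0n.
have v0 : vsq z0 = 0.
  rewrite /y_sqnorm big1// => j _.
  by rewrite /y_coord mxE eqxx eq_rlshift /= expr0n.
have pw1 s : pw s 1 = 1 :> R by rewrite pwE// powR1.
apply: (@ri_gt0 _ _ _ _ z0 (CC_radial d0 pf)) => [z|].
  by rewrite /radial_integrand /logpow !mulr_ge0 ?pw_ge0.
rewrite /radial_integrand /gauge_pow u1 v0 mulr0 addr0 !pw1 mul1r /logpow.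
by rewrite pw1 mul1r ln1 mulr0.
Qed.

Let is_derive_gauge a z : is_derive z (delta_mx 0 a) gauge (pd a gauge z).
Proof.
apply: DeriveDef => //; case: (split_ordP a) => [i|j] ->.
  by have [] := @is_derive_gauge_x R m k gamma gamma0 i z.
by have [] := @is_derive_gauge_y R m k gamma j z.
Qed.

Let pd_gauge_x i z : pd (lshift k i) gauge z = 2 * g * pw gamma (usq z) * xc i z.
Proof. by have [_] := @is_derive_gauge_x R m k gamma gamma0 i z. Qed.

Let pd_gauge_y j z : pd (rshift m j) gauge z = 2 * g ^+ 2 * yc j z.
Proof. by have [_] := @is_derive_gauge_y R m k gamma j z. Qed.

Let cont_pd_gauge a z : cont_at (pd a gauge) z.
Proof.
case: (split_ordP a) => [i|j] ->.
  rewrite (_ : pd _ gauge = fun z => 2 * g * pw gamma (usq z) * xc i z); last first.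
    by apply/funext => x; exact: pd_gauge_x.
  apply: cont_mul; last exact: cont_xc.
  by apply: cont_mul; [exact: cont_cst|exact: cont_pw_usq].
rewrite (_ : pd _ gauge = fun z => 2 * g ^+ 2 * yc j z); last first.
  by apply/funext => x; exact: pd_gauge_y.
by apply: cont_mul; [exact: cont_cst|exact: cont_yc].
Qed.

(** This is [euler_null] for f (d ln gauge), whose dilation derivative is 2 g d f'; at the exponent
    [cexp] the term of order zero drops out. *)
Lemma radial_derive d f f' : 0 < d -> supp1 f ->
  (forall t, is_derive (t : R^o) 1 f (f' t)) -> continuous f' -> radial d f' = 0.
Proof.
move=> d0 sf Df cf'.
have pf : profile f by split=> // t; exact: is_derive1_continuous (Df t).
have pf' : profile f' by split=> //; exact: supp1_derive sf Df.
(* The profile that [is_derive_logpow] yields at the exponent 0. *)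
pose h t := 0 * f t + d * f' t.
have ph : profile h by apply: profile_add; exact: profile_scale.
pose Phi z := logpow 0 d f (gauge z).
pose dPhi a z := logpow (0 - 1) d h (gauge z) * pd a gauge z.
have cPhi : CC (M d) Phi.
  split=> [z|z zM]; last first.
    by rewrite /Phi logpow_out//; right; exact: gauge_gt_box.
  apply: (@cont_comp _ _ _ (logpow 0 d f)); last exact: cont_gauge.
  exact: logpow_continuous.
have cdPhi a : CC (M d) (dPhi a).
  split=> [z|z zM]; last first.
    by rewrite /dPhi logpow_out ?mul0r//; [exact: ph.2|right; exact: gauge_gt_box].
  apply: (@cont_mul _ _ (fun z => logpow (0 - 1) d h (gauge z)) (pd a gauge)); last exact: cont_pd_gauge.
  apply: (@cont_comp _ _ _ (logpow (0 - 1) d h)); last exact: cont_gauge.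
  exact: logpow_continuous.
have DPhi a z : is_derive z (delta_mx 0 a) Phi (dPhi a z).
  apply: is_derive_fun_comp; last exact: is_derive_gauge.
  exact: is_derive_logpow.
have Phi0 : \forall z \near (0 : E), Phi z = 0.
  have : \forall z \near (0 : E), gauge z < expR (- d^-1).
    have := @cont_gauge R m k gamma gamma0 0; rewrite /cont_at /prop_for /continuous_at gauge0 => H.
    by apply: (H [set y | y < expR (- d^-1)]); apply: lt_nbhsl; exact: expR_gt0.
  by apply: filterS => z zd; rewrite /Phi logpow_out//; left.
have [_] := euler_null gamma0 cPhi cdPhi DPhi Phi0 cexp.
have g0 : 2 * g != 0 by rewrite gt_eqF// mulr_gt0// g_gt0.
have -> : Q + 2 * gamma + 2 * g * cexp = 0 by rewrite /cexp; field; move: g0; rewrite mulf_eq0 negb_or => /andP[].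
have E z : euler_op gamma dPhi z = 2 * g * d * logpow 0 d f' (gauge z).
  rewrite /euler_op.
  rewrite (eq_bigr (fun i => logpow (0 - 1) d h (gauge z) * (2 * g * pw gamma (usq z)) * xc i z ^+ 2)); last first.
    by move=> i _; rewrite /dPhi pd_gauge_x; ring.
  rewrite [X in _ + _ * X](eq_bigr (fun j => logpow (0 - 1) d h (gauge z) * (2 * g ^+ 2) * yc j z ^+ 2)); last first.
    by move=> j _; rewrite /dPhi pd_gauge_y; ring.
  rewrite -!mulr_sumr -/(usq z) -/(vsq z).
  transitivity (2 * g * (gauge z * logpow (0 - 1) d h (gauge z))).
    set X := logpow _ _ _ _.
    have -> : gauge z = usq z * pw gamma (usq z) + g ^+ 2 * vsq z.
      by rewrite /gauge_pow mul_usq_pw (addrC gamma).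
    ring.
  by rewrite mul_logpow ?gauge_ge0// /h /logpow; ring.
have -> : (fun z => pw gamma (usq z) * pw cexp (gauge z) * euler_op gamma dPhi z +
    0 * (pw gamma (usq z) * pw cexp (gauge z) * Phi z)) =
  (fun z => 2 * g * d * radial_integrand d f' z).
  apply/funext => z; rewrite E /radial_integrand /logpow mul0r addr0.
  (* [pw 0] is the indicator of the positive axis rather than 1; it is absorbed because it is
     idempotent. *)
  have <- : pw cexp (gauge z) * pw 0 (gauge z) = pw cexp (gauge z) by rewrite -pwD addr0.
  set p := pw 0 _; have pp : p * p = p by rewrite /p -pwD addr0.
  set c := pw cexp _; set b := pw gamma _; set v := f' _.
  transitivity (2 * g * d * (b * (c * (p * p) * v))); first by ring.
  by rewrite pp.
rewrite (riZ _ (CC_radial d0 pf')) => /eqP; rewrite mulf_eq0 => /orP[|/eqP//].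
by rewrite mulf_eq0 (negbTE g0) gt_eqF.
Qed.

(* Two functionals vanishing on derivatives are proportional to the integral
   of the profile, with a ratio which does not see [d]. *)
Lemma radial_ratio f h : profile f -> profile h -> 0 < \int[@lebesgue_measure R]_t h t ->
  exists theta, forall d, 0 < d -> radial d f = theta * radial d h.
Proof.
move=> pf ph h0; set I := Rintegral _ _ _ in h0.
(* With this ratio f - theta h has zero mean, hence a primitive that is again a profile. *)
pose theta := (\int[@lebesgue_measure R]_t f t) / I.
have p1 := profile_scale (- theta) ph; have p2 := profile_add pf p1.
have I0 : \int[@lebesgue_measure R]_t (f t + - theta * h t) = 0.
  have i1 := @CC1_integrable R 1 f pf.
  have i2 := @CC1_integrable R 1 h ph.
  have i3 := @CC1_integrable R 1 _ p1.
  by rewrite RintegralD// RintegralZl// -/I /theta mulNr divfK ?subrr// gt_eqF.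
have [F pF DF] := profile_primitive p2 I0.
exists theta => d d0; have := radial_derive d0 pF.2 DF p2.1.
rewrite radial_add// radial_scale// mulNr => /eqP; rewrite subr_eq0 => /eqP.
by [].
Qed.

End radial_functional.

(** * Sharpness of the constant *)

Section sharpness.
Variables (R : realType) (m k : nat) (gamma alpha : R).
Hypothesis gamma0 : 0 < gamma.
Hypothesis m0 : (0 < m)%N.
Hypothesis alpha2 : 2 < alpha.
Notation E := 'rV[R]_(m + k).
Notation g := (1 + gamma).
Notation usq := (@x_sqnorm R m k).
Notation vsq := (@y_sqnorm R m k).
Notation gauge := (@gauge_pow R m k gamma).
Notation Q := (Qdim m k gamma).
Notation be := ((alpha - 2) / (2 * g)).
Notation sg := ((Q + alpha - 4) / (4 * g)).
Notation radial := (@radial R m k gamma).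
Hypothesis alphaQ : alpha < Q.
Implicit Types (z : E) (w : R -> R) (d : R).

Let g0 : 0 < g. Proof. exact: g_gt0. Qed.
Let gn0 : 1 + gamma != 0. Proof. by rewrite gt_eqF. Qed.

Let gaugeE z : gauge z = usq z * pw gamma (usq z) + g ^+ 2 * vsq z.
Proof. by rewrite /gauge_pow mul_usq_pw (addrC gamma). Qed.

(** gauge^(- sg) is the virtual extremal: this [sg] makes the powers of the gauge add up to [cexp]
    and the coefficient of [w] proportional to (Q - alpha) / 2. *)
Lemma limit_lhs_family w w1 d :
  ri (@lhs_family R m k gamma alpha (logpow (- sg - 1) d w)
     (logpow (- sg - 1 - 1) d (fun x => (- sg - 1) * w x + d * w1 x)) 0) =
  radial d (fun t => (2 * g * (2 * g * d * w1 t + (Q - alpha) / 2 * w t)) ^+ 2).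
Proof.
congr ri; apply/funext => z.
rewrite /lhs_family /half_lapl !pexp_param0 rgauge_param0 /radial_integrand.
set F2 := logpow (- sg - 1 - 1) _ _ _; set F1 := logpow (- sg - 1) _ _ _.
set b := pw (gamma / 2) (usq z).
have Eb : pw gamma (usq z) = b * b by rewrite -pwD -splitr.
have -> : F2 * (4 * usq z * (b * g * (pw gamma (usq z) * g)) + 4 * g ^+ 4 * (vsq z * b)) +
   F1 * (4 * (b * (gamma * g)) + 2 * m%:R * (b * g) + 2 * g ^+ 2 * k%:R * b) =
   b * (4 * g ^+ 2 * (gauge z * F2) + 2 * g * (Q + 2 * gamma) * F1).
  by rewrite gaugeE /Qdim; ring.
rewrite mul_logpow ?gauge_ge0// /F1 /logpow Eb.
set p := pw (- sg - 1) _; set v := w _; set v1 := w1 _.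
have -> : pw (cexp m k gamma) (gauge z) = pw (be + 1) (gauge z) * (p * p).
  by rewrite /p -!pwD; congr (pw _ _); rewrite /cexp; field.
have -> : 4 * g ^+ 2 * (p * ((- sg - 1) * v + d * v1)) + 2 * g * (Q + 2 * gamma) * (p * v) =
  p * (2 * g * (2 * g * d * v1 + (Q - alpha) / 2 * v)) by field.
ring.
Qed.

Lemma limit_den_family w d :
  ri (@den_family R m k gamma alpha (logpow (- sg - 1) d w) 0) =
  radial d (fun t => (2 * g * w t) ^+ 2).
Proof.
congr ri; apply/funext => z.
rewrite /den_family /dgexp !pexp_param0 rgauge_param0 /radial_integrand /logpow.
set p := pw (- sg - 1) _; set v := w _; set b := pw gamma _.
have -> : 4 * usq z * (b * g) ^+ 2 + 4 * g ^+ 4 * (b * vsq z) = 4 * g ^+ 2 * b * gauge z.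
  by rewrite gaugeE -/b; ring.
have -> : pw (cexp m k gamma) (gauge z) = gauge z * (pw be (gauge z) * (p * p)).
  rewrite /p -!pwD mul_pw ?gauge_ge0//; congr (pw _ _); rewrite /cexp; field.
  by rewrite gn0.
ring.
Qed.

(** The cross term is a multiple of the derivative of w^2, on which [radial] vanishes; only a term
    with the factor d^2 is left beside the sharp constant. *)
Lemma limit_gap w w1 d : 0 < d -> profile w -> profile w1 ->
  (forall t, is_derive (t : R^o) 1 w (w1 t)) ->
  radial d (fun t => (2 * g * (2 * g * d * w1 t + (Q - alpha) / 2 * w t)) ^+ 2) =
  ((Q - alpha) / 2) ^+ 2 * radial d (fun t => (2 * g * w t) ^+ 2) +
  16 * g ^+ 4 * d ^+ 2 * radial d (fun t => w1 t ^+ 2).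
Proof.
move=> d0 pw_ pw1 Dw.
have p2 := profile_sqr pw_; have p3 := profile_sqr pw1.
have p4 : profile (fun t => w1 t * w t + w t * w1 t).
  by apply: profile_add; exact: profile_mul.
have z4 : radial d (fun t => w1 t * w t + w t * w1 t) = 0.
  apply: (@radial_derive R m k gamma gamma0 d (fun t => w t * w t)) => //.
  - exact: p2.2.
  - by move=> t; apply: is_derive_fun_mul.
  - exact: p4.1.
have -> : (fun t => (2 * g * (2 * g * d * w1 t + (Q - alpha) / 2 * w t)) ^+ 2) =
  (fun t => (16 * g ^+ 4 * d ^+ 2) * w1 t ^+ 2 + ((4 * g ^+ 3 * d * (Q - alpha)) * (w1 t * w t + w t * w1 t)
    + (((Q - alpha) / 2) ^+ 2 * (4 * g ^+ 2)) * w t ^+ 2)).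
  by apply/funext => t; field.
have -> : (fun t => (2 * g * w t) ^+ 2) = (fun t => (4 * g ^+ 2) * w t ^+ 2).
  by apply/funext => t; ring.
have s2 c := profile_scale c p2; have s3 c := profile_scale c p3; have s4 c := profile_scale c p4.
have RA f h := @radial_add R m k gamma gamma0 d f h d0.
have RS c f := @radial_scale R m k gamma gamma0 d c f d0.
rewrite RA//; last exact: profile_add.
by rewrite RA// !RS// z4; ring.
Qed.

Let sg0 : 0 < sg.
Proof.
have h : 0 < Q + alpha - 4 by move: alphaQ alpha2; lra.
by rewrite divr_gt0// mulr_gt0.
Qed.

(** Both profiles depend on [d], so each side is compared with [radial] of psi^2, the left one
    through ratios that do not depend on [d]. *)
Lemma gap_small psi psi1 psi2 (eps : R) : 0 < eps ->
  profile psi -> profile psi1 -> profile psi2 ->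
  (forall t, is_derive (t : R^o) 1 psi (psi1 t)) ->
  0 < psi 0 ->
  exists2 d, 0 < d &
    16 * g ^+ 4 * d ^+ 2 * radial d (fun t => (- sg * psi1 t + d * psi2 t) ^+ 2) <
    eps * radial d (fun t => (2 * g * (- sg * psi t + d * psi1 t)) ^+ 2).
Proof.
move=> e0 p0 p1 p2 D0 psi0.
have q0 := profile_sqr p0; have q1 := profile_sqr p1; have q2 := profile_sqr p2.
have I0 : 0 < \int[@lebesgue_measure R]_t (psi t ^+ 2).
  apply: (@CC1_gt0 R 1 (fun t => psi t ^+ 2) 0) => //.
    by move=> t; exact: sqr_ge0.
  by rewrite exprn_gt0.
have [th1 T1] := @radial_ratio R m k gamma gamma0 _ _ q1 q0 I0.
have [th2 T2] := @radial_ratio R m k gamma gamma0 _ _ q2 q0 I0.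
(* [K - 1] is the constant of the upper bound [up], rescaled; the added 1 makes [K] a positive
   denominator. *)
pose K := 4 * g ^+ 2 * (2 * sg ^+ 2 * `|th1| + 2 * `|th2|) + 1.
have K1 : 0 <= K - 1.
  have sq r : 0 <= 2 * r ^+ 2 :> R by rewrite mulr_ge0 ?sqr_ge0.
  rewrite /K addrK; apply: mulr_ge0; first by rewrite mulr_ge0 ?sqr_ge0.
  by apply: addr_ge0; apply: mulr_ge0.
have K0 : 0 < K by lra.
pose d := Num.min 1 (eps * sg ^+ 2 / (2 * K)).
have es0 : 0 < eps * sg ^+ 2 by rewrite mulr_gt0 ?exprn_gt0.
have d0 : 0 < d by rewrite lt_min ltr01 divr_gt0// mulr_gt0.
have d1 : d <= 1 by rewrite ge_min lexx.
have dK : d * K <= eps * sg ^+ 2 / 2.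
  have -> : eps * sg ^+ 2 / 2 = eps * sg ^+ 2 / (2 * K) * K.
    by field; rewrite gn0 gt_eqF.
  by rewrite ler_wpM2r ?(ltW K0)// ge_min lexx orbT.
have RA f h := @radial_add R m k gamma gamma0 d f h d0.
have RS c f := @radial_scale R m k gamma gamma0 d c f d0.
have J0 : 0 < radial d (fun t => psi t ^+ 2).
  have H := @radial_gt0 R m k gamma gamma0 d _ m0 d0 q0.
  by apply: H; [move=> t; exact: sqr_ge0|rewrite exprn_gt0].
exists d => //; set J := radial d (fun t => psi t ^+ 2) in J0.
have s0 c := profile_scale c q0; have s1 c := profile_scale c q1; have s2 c := profile_scale c q2.
have up : radial d (fun t => (- sg * psi1 t + d * psi2 t) ^+ 2) <=
    (2 * sg ^+ 2 * `|th1| + 2 * `|th2|) * J.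
  apply: (@le_trans _ _ (radial d (fun t => 2 * sg ^+ 2 * psi1 t ^+ 2 + 2 * d ^+ 2 * psi2 t ^+ 2))).
    apply: radial_le => //.
    - by apply: profile_sqr; apply: profile_add; exact: profile_scale.
    - exact: profile_add.
    move=> t; rewrite -subr_ge0.
    rewrite (_ : _ - _ = (sg * psi1 t + d * psi2 t) ^+ 2) ?sqr_ge0//; ring.
  rewrite RA// !RS// T1// T2// -/J [leRHS]mulrDl; apply: lerD.
    rewrite -[leRHS]mulrA; apply: ler_wpM2l; first by rewrite mulr_ge0 ?sqr_ge0.
    by apply: ler_wpM2r; [exact: ltW|exact: ler_norm].
  rewrite -[leRHS]mulrA -[leLHS]mulrA; apply: ler_wpM2l => //.
  have nJ : 0 <= `|th2| * J by rewrite mulr_ge0// ltW.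
  apply: (@le_trans _ _ (d ^+ 2 * (`|th2| * J))).
    apply: ler_wpM2l; first exact: sqr_ge0.
    by apply: ler_wpM2r; [exact: ltW|exact: ler_norm].
  by apply: ler_piMl => //; rewrite exprn_ile1// ltW.
have p4 : profile (fun t => psi1 t * psi t + psi t * psi1 t).
  by apply: profile_add; exact: profile_mul.
have z4 : radial d (fun t => psi1 t * psi t + psi t * psi1 t) = 0.
  apply: (@radial_derive R m k gamma gamma0 d (fun t => psi t * psi t)) => //.
  - exact: q0.2.
  - by move=> t; apply: is_derive_fun_mul.
  - exact: p4.1.
have s4 c := profile_scale c p4.
(* The cross term integrates to 0 and the term in psi1^2 is dropped. *)
have low : 4 * g ^+ 2 * (sg ^+ 2 * J) <= radial d (fun t => (2 * g * (- sg * psi t + d * psi1 t)) ^+ 2).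
  have -> : (fun t => (2 * g * (- sg * psi t + d * psi1 t)) ^+ 2) =
    (fun t => (4 * g ^+ 2 * sg ^+ 2) * psi t ^+ 2 + ((4 * g ^+ 2 * d ^+ 2) * psi1 t ^+ 2 +
       (- (4 * g ^+ 2 * sg * d)) * (psi1 t * psi t + psi t * psi1 t))).
    by apply/funext => t; ring.
  rewrite RA//; last exact: profile_add.
  rewrite RA// !RS// z4 mulr0 addr0 -/J mulrA lerDl.
  apply: mulr_ge0; first by rewrite !mulr_ge0 ?(ltW d0) ?(ltW g0).
  by apply: (@radial_ge0 R m k gamma gamma0 d _ d0 q1) => t; exact: sqr_ge0.
have h1 : 16 * g ^+ 4 * d ^+ 2 * radial d (fun t => (- sg * psi1 t + d * psi2 t) ^+ 2) <=
   16 * g ^+ 4 * d ^+ 2 * ((2 * sg ^+ 2 * `|th1| + 2 * `|th2|) * J).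
  by apply: ler_wpM2l => //; rewrite !mulr_ge0 ?exprn_ge0 ?(ltW d0) ?(ltW g0).
apply: (le_lt_trans h1).
have h2 : eps * (4 * g ^+ 2 * (sg ^+ 2 * J)) <=
    eps * radial d (fun t => (2 * g * (- sg * psi t + d * psi1 t)) ^+ 2).
  by rewrite ler_wpM2l// ltW.
apply: (lt_le_trans _ h2).
have -> : 16 * g ^+ 4 * d ^+ 2 * ((2 * sg ^+ 2 * `|th1| + 2 * `|th2|) * J) =
  4 * g ^+ 2 * J * (d * (d * (K - 1))) by rewrite /K; ring.
have -> : eps * (4 * g ^+ 2 * (sg ^+ 2 * J)) = 4 * g ^+ 2 * J * (eps * sg ^+ 2) by ring.
rewrite ltr_pM2l; last by rewrite !mulr_gt0// exprn_gt0.
have h3 : d * (d * (K - 1)) <= d * (K - 1) by rewrite ler_piMl// mulr_ge0// ltW.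
apply: (le_lt_trans h3); lra.
Qed.

(* The function [phi] is [gauge ^ - sg] times a cutoff which is spread over
   a long range of [ln gauge]; [sg] is the exponent of the virtual extremal. *)
Lemma exists_almost_extremal (eps : R) : 0 < eps -> exists phi : E -> R,
  [/\ admissible phi, exists z, phi z != 0, (0 < den_int gamma alpha phi)%E &
      (lhs_int gamma alpha phi <= (((Q - alpha) / 2) ^+ 2 + eps)%:E * den_int gamma alpha phi)%E].
Proof.
move=> e0.
(* The bump exp (- 1 / (1 - t^2)) on ]-1, 1[, extended by 0. *)
pose psi : R -> R := fun t => gexp 0 1 (1 + (-1) * (t * t)).
have spsi : smooth1 psi.
  apply: (@smooth1_comp _ (gexp 0 1)); first exact: smooth1_gexp.
  apply: smooth1_add; first exact: smooth1_cst.
  apply: smooth1_mul; first exact: smooth1_cst.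
  by apply: smooth1_mul; exact: smooth1_id.
have s0 : supp1 psi.
  move=> t t1; rewrite /psi gexp_le0// mulN1r subr_le0 -expr2 -real_normK ?num_real//.
  by rewrite exprn_ege1// ltW.
have psi0 : 0 < psi 0.
  by rewrite /psi mul0r mulr0 addr0 /gexp mulr_gt0 ?pw_gt0 ?expR_gt0.
have [psi1 spsi1 D0] := smooth1_derive spsi.
have [psi2 spsi2 D1] := smooth1_derive spsi1.
have s1 := supp1_derive s0 D0; have s2 := supp1_derive s1 D1.
have p0 : profile psi by split=> //; exact: smooth1_continuous.
have p1 : profile psi1 by split=> //; exact: smooth1_continuous.
have p2 : profile psi2 by split=> //; exact: smooth1_continuous.
have [d d0 small] := gap_small e0 p0 p1 p2 D0 psi0.
pose w t := - sg * psi t + d * psi1 t.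
pose w1 t := - sg * psi1 t + d * psi2 t.
have sw : smooth1 w.
  by apply: smooth1_add; apply: smooth1_mul => //; exact: smooth1_cst.
have sw1 : smooth1 w1.
  by apply: smooth1_add; apply: smooth1_mul => //; exact: smooth1_cst.
have Dw t : is_derive (t : R^o) 1 w (w1 t).
  by apply: is_derive_fun_add; exact: is_derive_fun_scale.
have pw_ : profile w by apply: profile_add; exact: profile_scale.
have pw1 : profile w1 by apply: profile_add; exact: profile_scale.
pose w2 t := (- sg - 1) * w t + d * w1 t.
have sw2 : smooth1 w2.
  by apply: smooth1_add; apply: smooth1_mul => //; exact: smooth1_cst.
have pw2 : profile w2 by apply: profile_add; exact: profile_scale.
pose F := logpow (- sg) d psi; pose F1 := logpow (- sg - 1) d w.
pose F2 := logpow (- sg - 1 - 1) d w2.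
have sF : smooth1 F by apply: smooth1_logpow.
have sF1 : smooth1 F1 by apply: smooth1_logpow => //; exact: pw_.2.
have sF2 : smooth1 F2 by apply: smooth1_logpow => //; exact: pw2.2.
have DF t : is_derive (t : R^o) 1 F (F1 t) by exact: is_derive_logpow.
have DF1 t : is_derive (t : R^o) 1 F1 (F2 t) by apply: is_derive_logpow => //; exact: pw_.2.
have FA t : t < expR (- d^-1) -> F t = 0 by move=> H; apply: logpow_out => //; left.
have FB t : expR d^-1 < t -> [/\ F t = 0, F1 t = 0 & F2 t = 0].
  by move=> H; split; apply: logpow_out => //; [right|exact: pw_.2|right|exact: pw2.2|right].
have A0 := expR_gt0 (- d^-1); have B0 := expR_gt0 d^-1.
pose ka := ((Q - alpha) / 2) ^+ 2.
have cl := cvg_lhs_family gamma0 alpha2 sF1 sF2 B0 FB (m := m) (k := k).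
have cd := cvg_den_family gamma0 alpha2 sF1 B0 FB (m := m) (k := k).
(* The strict inequality holds between the limit integrals at x = 0; continuity carries it to small
   nonzero x, where the test function is admissible. *)
pose gap x := (ka + eps) * ri (@den_family R m k gamma alpha F1 x) -
   ri (@lhs_family R m k gamma alpha F1 F2 x).
have gap0 : 0 < gap 0.
  rewrite /gap limit_lhs_family limit_den_family (limit_gap d0 pw_ pw1 Dw) -/ka.
  by move: small; rewrite -/w -/w1; lra.
have cg : gap (x ^+ 2) @[x --> (0 : R)] --> gap 0.
  by apply: cvgB => //; apply: cvgM => //; exact: cvg_cst.
have near_gap : \forall x \near (0 : R), 0 < gap (x ^+ 2).
  by apply: (cg [set y | 0 < y]); exact: lt_nbhsr.
have [x [x0 x1 gx]] : exists x : R, [/\ x != 0, `|x| <= 1 & 0 < gap (x ^+ 2)].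
  have : \forall x \near (0 : R)^', [/\ x != 0, `|x| <= 1 & 0 < gap (x ^+ 2)].
    near=> x; split; first by near: x; exact: nbhs_dnbhs_neq.
      by near: x; apply: nbhs_dnbhs; exact: near_norm_le1.
    by near: x; apply: nbhs_dnbhs; exact: near_gap.
  by move=> /filter_ex[x H]; exists x.
pose phi z := F (reg_gauge gamma (x ^+ 2) z).
have ap : admissible phi by exact: (admissible_family m k gamma0 sF A0 B0 FA FB x0 x1).
have El : lhs_int gamma alpha phi = (ri (@lhs_family R m k gamma alpha F1 F2 (x ^+ 2)))%:E.
  exact: (lhs_int_family m k gamma0 alpha2 sF1 sF2 DF DF1 B0 FB x0 x1).
have Ed : den_int gamma alpha phi = (ri (@den_family R m k gamma alpha F1 (x ^+ 2)))%:E.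
  exact: (den_int_family m k gamma0 alpha2 sF1 DF B0 FB x0 x1).
have l0 : (0 <= lhs_int gamma alpha phi)%E.
  rewrite -(iint0 R (m + k)); apply: le_iint => z; rewrite lee_fin.
  exact: lhs_integrand_ge0.
have ka0 : 0 <= ka by exact: sqr_ge0.
(* A positive gap together with a nonnegative left-hand integral forces the denominator to be
   positive. *)
have den0 : 0 < ri (@den_family R m k gamma alpha F1 (x ^+ 2)).
  rewrite El lee_fin in l0; have : 0 < (ka + eps) * ri (@den_family R m k gamma alpha F1 (x ^+ 2)).
    by move: gx; rewrite /gap; lra.
  by rewrite pmulr_rgt0// ltr_wpDl.
exists phi; split => //.
- apply: contrapT => nz.
  have phi0 : phi = fun=> 0.
    by apply/funext => z; apply/eqP; apply: contrapT => /negP nz0; apply: nz; exists z.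
  have dphi a z : pd a phi z = 0 by rewrite phi0 /pd; exact: derive_cst.
  move: den0; rewrite -lte_fin -Ed den_int_ri// (_ : ri _ = 0) ?ltxx//.
  rewrite -(ri0 R (m + k)); congr ri; apply/funext => z.
  rewrite /gradsq !big1 ?mulr0 ?addr0 ?mulr0// => i _; by rewrite dphi expr0n.
- by rewrite Ed lte_fin.
- by rewrite El Ed -EFinM lee_fin ltW// -subr_gt0.
Unshelve. all: by end_near. Qed.

End sharpness.
Theorem theorem4p5 (R : realType) (m k : nat) (gamma alpha : R) :
  (0 < m)%N -> (0 < k)%N -> 0 < gamma ->
  2 < alpha -> alpha < Qdim m k gamma ->
  (forall phi : 'rV[R]_(m + k) -> R, admissible phi ->
     (lhs_int gamma alpha phi >=
        (((Qdim m k gamma - alpha) ^+ 2 / 4)%:E * rhs_int gamma alpha phi))%E)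
  /\
  ereal_inf [set (lhs_int gamma alpha phi / den_int gamma alpha phi)%E
            | phi in [set phi : 'rV[R]_(m + k) -> R |
                        admissible phi /\ exists z, phi z != 0]]
    = (((Qdim m k gamma - alpha) / 2) ^+ 2)%:E.
Proof.
move=> m0 k0 gamma0 alpha2 alphaQ; split=> [phi aphi|].
  by rewrite rhs_int_den_int//; exact: hardy_rellich_admissible.
set ka := ((Qdim m k gamma - alpha) / 2) ^+ 2.
apply/eqP; rewrite eq_le; apply/andP; split.
  apply/lee_addgt0Pr => e e0.
  have [phi [aphi [z0 nz] den0 H]] := exists_almost_extremal gamma0 m0 alpha2 alphaQ e0.
  apply: (@le_trans _ _ (lhs_int gamma alpha phi / den_int gamma alpha phi)%E).
    by apply: ereal_inf_lbound; exists phi => //; split => //; exists z0.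
  by move: den0 H; rewrite den_int_ri// lte_fin => d0; rewrite inver gt_eqF// lee_pdivrMr.
apply: le_ereal_inf_tmp => _ [phi [aphi [z0 nz]] <-].
have den0 := den_int_gt0 gamma0 alpha2 m0 aphi nz.
have := hardy_rellich_admissible gamma0 alpha2 m0 alphaQ aphi.
move: den0; rewrite den_int_ri// lte_fin => d0; rewrite inver gt_eqF// lee_pdivlMr//.
by rewrite /ka expr_div_n (_ : 2 ^+ 2 = 4)//; ring.
Qed.
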